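(* Let $M_t$, $t\in[0,T)$, be a family of smooth closed strictly convex surfaces in $\mathbb{R}^3$ flowing according to $\frac{d}{dt}X=-H^4\nu$. Then $$\max_{M_t}\frac{(\lambda_1^2+\lambda_1\lambda_2+\lambda_2^2)(\lambda_1+\lambda_2)^6(\lambda_1-\lambda_2)^2}{2\lambda_1^2\lambda_2^2}$$ is non-increasing in time.
   Context: A closed surface is a compact connected embedded surface without boundary. $X=X(x,t)$ is the (smooth) embedding vector of $M_t$ into $\mathbb{R}^3$, $\frac{d}{dt}X$ its total time derivative, and $\nu$ the outer unit normal to $M_t$. The principal curvatures $\lambda_1,\lambda_2$ are the eigenvalues of the second fundamental form with respect to the induced metric, with sign such that round spheres have positive principal curvatures. A surface is strictly convex if all its principal curvatures are strictly positive. $H=\lambda_1+\lambda_2$. *)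

(* Defs.v *)
From HB Require Import structures.
From mathcomp Require Import all_boot all_order all_algebra.
From mathcomp Require Import all_classical all_reals all_analysis.

Set Implicit Arguments.
Unset Strict Implicit.
Unset Printing Implicit Defensive.

Import Order.TTheory GRing.Theory Num.Theory.
Import numFieldNormedType.Exports.

Local Open Scope classical_set_scope.
Local Open Scope ring_scope.

Section Smooth.
Context {R : realType} {V W : normedModType R}.
Implicit Types (U A : set V) (f : V -> W).

(* For [V] finite-dimensional and [U] open this is the usual class C^k:
   all iterated directional derivatives up to order [k] exist and are
   continuous on [U]. *)
Fixpoint Ck (k : nat) U f : Prop :=
  match k with
  | 0 => forall x, U x -> {for x, continuous f}
  | k'.+1 => (forall x, U x -> differentiable f x) /\
             (forall v, Ck k' U (fun x => 'D_v f x))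
  end.

Definition smooth U f : Prop := forall k, Ck k U f.

(* Smoothness on a set that need not be open (below, a chart times [0, T)):
   local existence of smooth extensions. *)
Definition smooth_on A f : Prop :=
  forall x, A x -> exists U (g : V -> W),
    [/\ open U, U x, smooth U g & forall y, U y -> A y -> g y = f y].

End Smooth.

(* A smooth atlas of dimension 2, all charts being onto open subsets of the
   plane (no boundary).  [chart i] and [param i] are mutually inverse
   homeomorphisms between [chart_dom i] and [chart_cod i]; their values
   elsewhere are irrelevant. *)
Record surface_atlas (R : realType) (M : topologicalType) := SurfaceAtlas {
  chart_index : Type;
  chart_dom : chart_index -> set M;
  chart_cod : chart_index -> set 'rV[R]_2;
  chart : chart_index -> M -> 'rV[R]_2;
  param : chart_index -> 'rV[R]_2 -> M;
  chart_dom_open : forall i, open (chart_dom i);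
  chart_cod_open : forall i, open (chart_cod i);
  chart_cover : forall x, exists i, chart_dom i x;
  chart_fun : forall i x, chart_dom i x -> chart_cod i (chart i x);
  param_fun : forall i u, chart_cod i u -> chart_dom i (param i u);
  chartK : forall i x, chart_dom i x -> param i (chart i x) = x;
  paramK : forall i u, chart_cod i u -> chart i (param i u) = u;
  chart_continuous : forall i x, chart_dom i x -> {for x, continuous (chart i)};
  param_continuous : forall i u, chart_cod i u -> {for u, continuous (param i)};
  transition_smooth : forall i j,
    smooth (chart_cod i `&` param i @^-1` chart_dom j) (chart j \o param i)
}.

Definition closed_manifold (M : topologicalType) : Prop :=
  [/\ [set: M] !=set0, compact [set: M], connected [set: M]
    & hausdorff_space M].

Section Surfaces.
Context {R : realType} {M : topologicalType}.
Variable A : surface_atlas R M.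
Implicit Types (f : M -> 'rV[R]_3) (n : 'rV[R]_3) (x : M) (u : 'rV[R]_2).

Definition dot (v w : 'rV[R]_3) : R := (v *m w^T) 0 0.

Definition local_param f (i : chart_index A) : 'rV[R]_2 -> 'rV[R]_3 :=
  f \o param i.

Definition partial (j : 'I_2) (F : 'rV[R]_2 -> 'rV[R]_3) u : 'rV[R]_3 :=
  'D_(delta_mx 0 j) F u.

Definition frame (F : 'rV[R]_2 -> 'rV[R]_3) u : 'M[R]_(2, 3) :=
  \matrix_(j < 2) partial j F u.

Definition smooth_embedding f : Prop :=
  [/\ forall i, smooth (chart_cod i) (local_param f i),
      forall i u, chart_cod i u -> row_free (frame (local_param f i) u),
      injective f
    & forall U : set M, open U -> exists2 V, open V & U = f @^-1` V].

Definition exterior (S : set 'rV[R]_3) : set 'rV[R]_3 :=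
  [set y | ~ S y /\ ~ bounded_set (connected_component (~` S) y)].

Definition outer_unit_normal f x n : Prop :=
  [/\ dot n n = 1,
      forall (i : chart_index A) u, chart_cod i u -> param i u = x ->
        forall j, dot n (partial j (local_param f i) u) = 0
    & \forall s \near 0^'+, exterior (range f) (f x + s *: n)].

Definition first_form (F : 'rV[R]_2 -> 'rV[R]_3) u : 'M[R]_2 :=
  \matrix_(j, k) dot (partial j F u) (partial k F u).

(* For the outer normal, the minus sign makes this form positive definite on
   round spheres. *)
Definition second_form (F : 'rV[R]_2 -> 'rV[R]_3) u n : 'M[R]_2 :=
  \matrix_(j, k) - dot (partial j (partial k F) u) n.

(* [l1] and [l2] are the eigenvalues, with multiplicity, of the second
   fundamental form with respect to the first one, in every chart at [x]. *)
Definition principal_curvatures f n x (l1 l2 : R) : Prop :=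
  forall (i : chart_index A) u, chart_cod i u -> param i u = x ->
    let F := local_param f i in
    char_poly (second_form F u n *m invmx (first_form F u)) =
    ('X - l1%:P) * ('X - l2%:P).

End Surfaces.

Section Flow.
Context {R : realType} {M : topologicalType}.
Variable A : surface_atlas R M.

Definition time_interval (T : \bar R) : set R :=
  [set t | 0 <= t /\ (t%:E < T)%E].

Definition smooth_in_spacetime (T : \bar R) (X : M -> R -> 'rV[R]_3) : Prop :=
  forall i : chart_index A,
    smooth_on (chart_cod i `*` time_interval T : set ('rV[R]_2 * R^o)%type)
              (fun z => X (param i z.1) z.2).

(* The derivative is taken within the time interval, so it is one-sided at
   the initial time. *)
Definition time_derivative (T : \bar R) (c : R -> 'rV[R]_3) (t : R)
    (d : 'rV[R]_3) : Prop :=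
  (s - t)^-1 *: (c s - c t) @[s --> within (time_interval T) t^'] --> d.

End Flow.

Definition pinching (R : realType) (l1 l2 : R) : R :=
  ((l1 ^+ 2 + l1 * l2 + l2 ^+ 2) * (l1 + l2) ^+ 6 * (l1 - l2) ^+ 2) /
  (2 * l1 ^+ 2 * l2 ^+ 2).

Definition is_max (R : realType) (S : set R) (m : R) : Prop :=
  S m /\ ubound S m.

(* Main.v *)
Require Import Defs.
From HB Require Import structures.
From mathcomp Require Import all_boot all_order all_algebra.
From mathcomp Require Import all_classical all_reals all_analysis.
From mathcomp Require Import ring lra.
Set Implicit Arguments.
Unset Strict Implicit.
Unset Printing Implicit Defensive.
Import Order.TTheory GRing.Theory Num.Theory.
Import numFieldNormedType.Exports.
Local Open Scope classical_set_scope.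
Local Open Scope ring_scope.

(** Why the theorem holds.

In terms of the mean curvature H and the Gauss curvature K, the quantity is
w = (H^10 / K^2 - 5 H^8 / K + 4 H^6) / 2, a symmetric function of the
principal curvatures a and b.  By the maximum principle
([max_nonincreasing]) the maximum of w over the compact surface does not
increase as soon as, at every positive time t and every point x where
w(., t) is maximal, the time derivative of w is nonpositive.  At an umbilic
point w vanishes, which is its minimal value, so w vanishes identically at
time t and there is nothing to prove.

At a maximal point that is not umbilic, let F = H^4 be the speed.  The shape
operator S satisfies dS/dt = Hess F + F S^2, which gives dw/dt in terms of
the Hessian of H.  On the other hand the Laplacian of w is nonpositive
there, and the Laplacian of K is tr (cof(S) Hess H) - (a - b)^2 K plus
products of first derivatives of S, by the identity of Simons ([simons]).
Subtracting 4 H^3 times the Laplacian of w from dw/dt cancels all the second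
derivatives of the curvatures.  The remaining terms of order zero add up to
- 3 H^9 (a - b)^4 / (2 K).  The remaining terms are quadratic in the first
derivatives of a and b.  Along each principal direction the equation dw = 0
determines the ratio of the derivatives of a and b, and the quadratic terms
become minus a square times a homogeneous polynomial in a and b that is
nonnegative for positive a and b ([gradient_terms_le0]).

The geometric identities are proved by differential algebra.  Near a point
of space-time the smooth functions form a commutative ring [smfun] with
commuting derivations, two in space and one in time, and the equations of
Gauss, Codazzi and Weingarten and the evolution equation of S are
consequences of the Leibniz rule in any such ring.  No special coordinates
are chosen, except that the two directions of differentiation are principal
and orthonormal at the point under consideration; the Christoffel symbols
stay in the computation, and cancel.  The unit normal is a smooth function of
space-time because strict convexity selects one of the two unit normals: the
one for which H is positive ([local_orientation]). *)

(** * The pinching function of the mean and the Gauss curvature *)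

Section PinchingDefs.
Variable A : comNzRingType.
Implicit Types H J x y : A.

(** With J standing for 1 / K, this is twice the pinching function, so that
it is polynomial and makes sense in every commutative ring. *)
Definition pinchHJ H J : A := H ^+ 10 * J ^+ 2 - 5 * H ^+ 8 * J + 4 * H ^+ 6.
(** Partial derivatives with respect to H and K, where J = 1 / K depends on
K: the derivative of J is - J^2. *)
Definition pinchHJ_dH H J : A := 10 * H ^+ 9 * J ^+ 2 - 40 * H ^+ 7 * J + 24 * H ^+ 5.
Definition pinchHJ_dK H J : A := - 2 * H ^+ 10 * J ^+ 3 + 5 * H ^+ 8 * J ^+ 2.
Definition pinchHJ_dHH H J : A := 90 * H ^+ 8 * J ^+ 2 - 280 * H ^+ 6 * J + 120 * H ^+ 4.
Definition pinchHJ_dHK H J : A := - 20 * H ^+ 9 * J ^+ 3 + 40 * H ^+ 7 * J ^+ 2.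
Definition pinchHJ_dKK H J : A := 6 * H ^+ 10 * J ^+ 4 - 10 * H ^+ 8 * J ^+ 3.

Definition pinchHJ_hess H J x y : A :=
  pinchHJ_dHH H J * x ^+ 2 + 2 * pinchHJ_dHK H J * x * y + pinchHJ_dKK H J * y ^+ 2.
End PinchingDefs.

Section PinchingFunction.
Variable R : realFieldType.
Implicit Types H J a b : R.

(** This is the polynomial left over from the gradient terms, see
[gradient_terms_le0]. *)
Lemma gradient_poly_ge0 a b : 0 < a -> 0 < b ->
  0 <= 40 * b ^+ 10 + 4 * a * b ^+ 9 - 78 * a ^+ 2 * b ^+ 8
     + 161 * a ^+ 3 * b ^+ 7 - 511 * a ^+ 4 * b ^+ 6 + 696 * a ^+ 5 * b ^+ 5
     - 16 * a ^+ 6 * b ^+ 4 + 809 * a ^+ 7 * b ^+ 3 - 447 * a ^+ 8 * b ^+ 2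
     + 202 * a ^+ 9 * b + 4 * a ^+ 10.
Proof.
move=> a0 b0.
have mono i j : 0 <= a ^+ i * b ^+ j by rewrite mulr_ge0 // exprn_ge0 // ltW.
have sq i j (x : R) : 0 <= a ^+ i * b ^+ j * x ^+ 2.
  by rewrite mulr_ge0 // sqr_ge0.
(* The first three squares absorb the negative terms in a^8, a^6 and a^4
   between their neighbours of odd degree; the last two absorb the term in
   a^2. *)
have s1 := sq 7%N 1%N (202 * a - 447 / 2 * b).
have s2 := sq 5%N 3%N (a - b).
have s3 := sq 3%N 5%N (688 * a - 511 / 2 * b).
have s4 := sq 1%N 7%N (5 * a - 4 * b).
have s5 := sq 0%N 8%N (5 * a - 4 * b).
have m1 := mono 10%N 0%N. have m2 := mono 7%N 3%N. have m3 := mono 3%N 7%N.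
have m4 := mono 1%N 9%N. have m5 := mono 0%N 10%N. have m6 := mono 5%N 5%N.
lra.
Qed.

(** In a principal direction, x and y are the derivatives of the principal
curvatures a and b.  The hypothesis says that the derivative of the pinching
function vanishes, which determines the ratio of x and y; the quadratic form
is then a negative multiple of the polynomial of [gradient_poly_ge0].  The
first term comes from the second derivative of the speed H^4, the second one
from the Laplacian of K, the third one from the Hessian of the pinching
function. *)
Lemma gradient_terms_le0 a b x y : 0 < a -> 0 < b -> a != b ->
  let H := a + b in let J := (a * b)^-1 in
  pinchHJ_dH H J * (x + y) + pinchHJ_dK H J * (b * x + a * y) = 0 ->
  12 * H ^+ 2 * (pinchHJ_dH H J + b * pinchHJ_dK H J) * (x + y) ^+ 2
  - 8 * H ^+ 3 * pinchHJ_dK H J * (x * y - y ^+ 2)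
  - 4 * H ^+ 3 * pinchHJ_hess H J (x + y) (b * x + a * y) <= 0.
Proof.
move=> a0 b0 ab H J crit.
have a1 : a != 0 by rewrite gt_eqF.
have b1 : b != 0 by rewrite gt_eqF.
have H0 : 0 < H by rewrite addr_gt0.
set q1 := 2 * b ^+ 4 - 3 * a * b ^+ 3 + 2 * a ^+ 2 * b ^+ 2 + 3 * a ^+ 3 * b + 8 * a ^+ 4.
set q2 := - 8 * b ^+ 4 - 3 * a * b ^+ 3 - 2 * a ^+ 2 * b ^+ 2 + 3 * a ^+ 3 * b - 2 * a ^+ 4.
have crit' : b * q1 * x + a * q2 * y = 0.
  pose c := H ^+ 5 * (a - b) / (a ^+ 3 * b ^+ 3).
  have c0 : c != 0.
    have Hn : H != 0 by rewrite gt_eqF.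
    by rewrite mulf_neq0 ?invr_neq0 ?mulf_neq0 ?expf_neq0 ?subr_eq0.
  apply: (mulfI c0); rewrite mulr0 -[RHS]crit.
  by rewrite /c /pinchHJ_dH /pinchHJ_dK /J /H /q1 /q2; field; rewrite a1 b1.
set S := b * q1 - a * q2.
have S0 : 0 < S.
  have mono i j : 0 < a ^+ i * b ^+ j by rewrite mulr_gt0 // exprn_gt0.
  have := (mono 5 0, mono 4 1, mono 3 2, mono 2 3, mono 1 4, mono 0 5)%N.
  by rewrite /S /q1 /q2 => -[[[[[]]]]]; lra.
(* The critical equation b q1 x + a q2 y = 0 is solved by x = a q2 s and
   y = - b q1 s. *)
pose s := - (x + y) / S.
have Sn0 : S != 0 by rewrite gt_eqF.
have -> : x = a * q2 * s.
  rewrite /s mulrA; apply: (mulIf Sn0); rewrite divfK //.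
  by rewrite /S; move: crit'; lra.
have -> : y = - (b * q1 * s).
  rewrite /s mulrA -mulNr; apply: (mulIf Sn0); rewrite divfK //.
  by rewrite /S; move: crit'; lra.
set P := 40 * b ^+ 10 + 4 * a * b ^+ 9 - 78 * a ^+ 2 * b ^+ 8
     + 161 * a ^+ 3 * b ^+ 7 - 511 * a ^+ 4 * b ^+ 6 + 696 * a ^+ 5 * b ^+ 5
     - 16 * a ^+ 6 * b ^+ 4 + 809 * a ^+ 7 * b ^+ 3 - 447 * a ^+ 8 * b ^+ 2
     + 202 * a ^+ 9 * b + 4 * a ^+ 10.
have P0 : 0 <= P by exact: gradient_poly_ge0.
rewrite [leLHS](_ : _ = - (4 * H ^+ 11 * P * s ^+ 2 / (a ^+ 3 * b))); last first.
  rewrite /pinchHJ_dH /pinchHJ_dK /pinchHJ_hess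
    /pinchHJ_dHH /pinchHJ_dHK /pinchHJ_dKK /J /H /q1 /q2 /P.
  by move: s => s; field; rewrite a1 b1.
have d0 : 0 < a ^+ 3 * b by rewrite mulr_gt0 // exprn_gt0.
rewrite oppr_le0 divr_ge0 ?(ltW d0) // mulr_ge0 ?sqr_ge0 // mulr_ge0 //.
by rewrite mulr_ge0 // exprn_ge0 // ltW.
Qed.

(** The heart of the maximum principle.  Here (x1, y1) and (x2, y2) are the
derivatives of the principal curvatures (a, b) in the two principal
directions, hs1 and hs2 the diagonal entries of the covariant Hessian of H,
lapK the Laplacian of K given by the identity of Simons, Ht and Kt the time
derivatives under the flow.  Subtracting 4 H^3 times the Laplacian of the
pinching function from its time derivative eliminates hs1 and hs2. *)
Lemma pinching_reaction_le0 a b x1 y1 x2 y2 hs1 hs2 lapK Ht Kt :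
  0 < a -> 0 < b -> a != b ->
  let H := a + b in let K := a * b in let J := K^-1 in
  let H1 := x1 + y1 in let H2 := x2 + y2 in
  let K1 := b * x1 + a * y1 in let K2 := b * x2 + a * y2 in
  lapK = b * hs1 + a * hs2 - (a - b) ^+ 2 * K
         + 2 * (x1 * y1 + x2 * y2 - x2 ^+ 2 - y1 ^+ 2) ->
  Ht = 4 * H ^+ 3 * (hs1 + hs2) + 12 * H ^+ 2 * (H1 ^+ 2 + H2 ^+ 2)
       + H ^+ 4 * (a ^+ 2 + b ^+ 2) ->
  Kt = b * (4 * H ^+ 3 * hs1 + 12 * H ^+ 2 * H1 ^+ 2)
       + a * (4 * H ^+ 3 * hs2 + 12 * H ^+ 2 * H2 ^+ 2) + H ^+ 4 * K * H ->
  pinchHJ_dH H J * H1 + pinchHJ_dK H J * K1 = 0 ->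
  pinchHJ_dH H J * H2 + pinchHJ_dK H J * K2 = 0 ->
  pinchHJ_dH H J * (hs1 + hs2) + pinchHJ_dK H J * lapK
    + pinchHJ_hess H J H1 K1 + pinchHJ_hess H J H2 K2 <= 0 ->
  pinchHJ_dH H J * Ht + pinchHJ_dK H J * Kt <= 0.
Proof.
move=> a0 b0 ab H K J H1 H2 K1 K2 -> -> -> crit1 crit2.
set lapW := (X in X <= 0 -> _) => lapW_le0.
have T1 := gradient_terms_le0 a0 b0 ab crit1.
have ba : b != a by rewrite eq_sym.
have T2 := @gradient_terms_le0 b a y2 x2 b0 a0 ba.
rewrite /= (addrC b a) (mulrC b a) (addrC y2 x2) (addrC (a * y2)) in T2.
have {}T2 := T2 crit2.
have H0 : 0 < H by rewrite addr_gt0.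
(* Z collects the terms of order zero. *)
set t1 := (X in X <= 0) in T1; set t2 := (X in X <= 0) in T2.
set Z := 3 * H ^+ 9 * (a - b) ^+ 4 * J.
have Z0 : 0 <= Z.
  have K0 : 0 < K by rewrite mulr_gt0.
  rewrite /Z mulr_ge0 ?invr_ge0 ?(ltW K0) // mulr_ge0 ?exprn_even_ge0 //.
  by rewrite mulr_ge0 // exprn_ge0 // ltW.
rewrite [leLHS](_ : _ = 4 * H ^+ 3 * lapW + t1 + t2 - Z); last first.
  rewrite /lapW /t1 /t2 /Z /pinchHJ_hess /pinchHJ_dH /pinchHJ_dK
    /pinchHJ_dHH /pinchHJ_dHK /pinchHJ_dKK.
  rewrite /J /H1 /H2 /K1 /K2 /K /H; field.
  by rewrite !gt_eqF.
have : 4 * H ^+ 3 * lapW <= 0.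
  by rewrite mulr_ge0_le0 // mulr_ge0 // exprn_ge0 // ltW.
move: T1 T2 Z0; rewrite -/t1 -/t2; lra.
Qed.
End PinchingFunction.

(** * Derivations, moving frames and the equations of a surface *)

Record derivation (A : comNzRingType) := Derivation {
  der :> A -> A;
  derD : forall f g, der (f + g) = der f + der g;
  derM : forall f g, der (f * g) = der f * g + f * der g }.

Section DerivationTheory.
Variables (A : comNzRingType) (d : derivation A).
Implicit Types f g H J K : A.

Lemma der0 : d 0 = 0.
Proof. by apply: (addrI (d 0)); rewrite -derD !addr0. Qed.

Lemma der1 : d 1 = 0.
Proof.
by apply: (addrI (d 1)); rewrite addr0 -{3}[1]mulr1 derM mulr1 mul1r.
Qed.

Lemma derN f : d (- f) = - d f.
Proof. by apply: (addrI (d f)); rewrite -derD !subrr der0. Qed.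

Lemma derB f g : d (f - g) = d f - d g.
Proof. by rewrite derD derN. Qed.

Lemma der_nat n : d n%:R = 0.
Proof.
by elim: n => [|n IH]; [exact: der0 | rewrite -natr1 derD IH der1 addr0].
Qed.

Lemma derX f n : d (f ^+ n) = n%:R * f ^+ n.-1 * d f.
Proof.
elim: n => [|[|n] IH]; first by rewrite expr0 der1 !mul0r.
  by rewrite expr1 expr0 !mul1r.
by rewrite exprS derM IH /= exprS -[n.+2%:R]natr1; ring.
Qed.

Definition derE := (der_nat, der1, derB, derD, derM, derN, derX).

Lemma der_inv K J : K * J = 1 -> d J = - J ^+ 2 * d K.
Proof.
move=> KJ; have E : d K * J + K * d J = 0 by rewrite -derM KJ der1.
rewrite -[d J]mul1r -KJ.
transitivity (J * (d K * J + K * d J) - J ^+ 2 * d K); first by ring.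
by rewrite E mulr0 add0r mulNr.
Qed.

Lemma der_pinchHJ H K J : K * J = 1 ->
  d (pinchHJ H J) = pinchHJ_dH H J * d H + pinchHJ_dK H J * d K.
Proof.
move=> KJ; rewrite /pinchHJ /pinchHJ_dH /pinchHJ_dK.
by rewrite !derE (der_inv KJ) /=; ring.
Qed.

Lemma der_der_pinchHJ H K J : K * J = 1 ->
  d (d (pinchHJ H J)) = pinchHJ_dH H J * d (d H) + pinchHJ_dK H J * d (d K)
    + pinchHJ_hess H J (d H) (d K).
Proof.
move=> KJ; rewrite (der_pinchHJ H KJ) /pinchHJ_hess /pinchHJ_dH /pinchHJ_dK
    /pinchHJ_dHH /pinchHJ_dHK /pinchHJ_dKK.
by rewrite !derE (der_inv KJ) /=; ring.
Qed.

End DerivationTheory.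

Section Frame.
Variable A : comNzRingType.
Implicit Types (u v w x y n : 'I_3 -> A) (G : A).

Definition ip u v : A := u 0 * v 0 + u 1 * v 1 + u 2 * v 2.

Lemma ipC u v : ip u v = ip v u.
Proof. by rewrite /ip; ring. Qed.

Lemma der_ip (d : derivation A) u v :
  d (ip u v) = ip (fun c => d (u c)) v + ip u (fun c => d (v c)).
Proof. by rewrite /ip !derE; ring. Qed.

(** The inverse G of the Gram determinant is part of the data because the ring
need not contain quotients. *)
Definition moving_frame x y n G :=
  [/\ ip n n = 1, ip n x = 0, ip n y = 0 &
      G * (ip x x * ip y y - ip x y ^+ 2) = 1].

(** The difference z of the two sides is orthogonal to the whole frame, hence
its product with the determinant of the frame vanishes by Cramer's rule; this
determinant is invertible because its square is the Gram determinant. *)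
Lemma frame_decomp x y n G : moving_frame x y n G -> forall v c,
  v c = G * (ip v x * ip y y - ip v y * ip x y) * x c
      + G * (ip v y * ip x x - ip v x * ip x y) * y c + ip v n * n c.
Proof.
move=> [nn nx ny gram] v.
pose p := G * (ip v x * ip y y - ip v y * ip x y).
pose q := G * (ip v y * ip x x - ip v x * ip x y).
pose z c := v c - (p * x c + q * y c + ip v n * n c).
have zE u : ip z u = ip v u - (p * ip x u + q * ip y u + ip v n * ip n u).
  by rewrite /z /ip; ring.
have zx : ip z x = 0.
  rewrite zE nx (ipC y x).
  transitivity (ip v x * (1 - G * (ip x x * ip y y - ip x y ^+ 2))).
    by rewrite /p /q; ring.
  by rewrite gram subrr mulr0.
have zy : ip z y = 0.
  rewrite zE ny.
  transitivity (ip v y * (1 - G * (ip x x * ip y y - ip x y ^+ 2))).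
    by rewrite /p /q; ring.
  by rewrite gram subrr mulr0.
have zn : ip z n = 0 by rewrite zE (ipC x) (ipC y) nn nx ny; ring.
pose D := x 0 * (y 1 * n 2 - y 2 * n 1) + x 1 * (y 2 * n 0 - y 0 * n 2)
          + x 2 * (y 0 * n 1 - y 1 * n 0).
(* The square of the determinant of the frame is its Gram determinant. *)
have DD : G * D ^+ 2 = 1.
  rewrite -gram; congr (_ * _).
  transitivity (ip n n * (ip x x * ip y y - ip x y ^+ 2)
    - ip n x * (ip n x * ip y y - ip n y * ip x y)
    - ip n y * (ip n y * ip x x - ip n x * ip x y)).
    by rewrite /D /ip; ring.
  by rewrite nn nx ny; ring.
(* Cramer's rule: the rows of the adjugate are the cross products. *)
have Dz c : D * z c = 0.
  pose t := ip z x; pose s := ip z y; pose r := ip z n.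
  have E0 : D * z 0 = t * (y 1 * n 2 - y 2 * n 1)
     + s * (n 1 * x 2 - n 2 * x 1) + r * (x 1 * y 2 - x 2 * y 1).
    by rewrite /t /s /r /ip /D; ring.
  have E1 : D * z 1 = t * (y 2 * n 0 - y 0 * n 2)
     + s * (n 2 * x 0 - n 0 * x 2) + r * (x 2 * y 0 - x 0 * y 2).
    by rewrite /t /s /r /ip /D; ring.
  have E2 : D * z 2 = t * (y 0 * n 1 - y 1 * n 0)
     + s * (n 0 * x 1 - n 1 * x 0) + r * (x 0 * y 1 - x 1 * y 0).
    by rewrite /t /s /r /ip /D; ring.
  move: E0 E1 E2; rewrite /t /s /r zx zy zn !mul0r !add0r => E0 E1 E2.
  case: c => -[|[|[|//]]] c3.
  - by rewrite -E0; congr (_ * z _); apply: val_inj.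
  - by rewrite -E1; congr (_ * z _); apply: val_inj.
  - by rewrite -E2; congr (_ * z _); apply: val_inj.
move=> c; apply/eqP; rewrite -subr_eq0; apply/eqP; rewrite -/p -/q -/(z c).
by rewrite -[z c]mul1r -DD expr2 -!mulrA Dz !mulr0.
Qed.

Lemma frame_free x y n G : moving_frame x y n G -> forall p q r,
  (forall c, p * x c + q * y c + r * n c = 0) -> [/\ p = 0, q = 0 & r = 0].
Proof.
move=> [nn nx ny gram] p q r E.
have ipE u : p * ip x u + q * ip y u + r * ip n u = 0.
  transitivity ((p * x 0 + q * y 0 + r * n 0) * u 0
    + (p * x 1 + q * y 1 + r * n 1) * u 1
    + (p * x 2 + q * y 2 + r * n 2) * u 2); first by rewrite /ip; ring.
  by rewrite !E; ring.
have := ipE n; rewrite (ipC x) (ipC y) nn nx ny !mulr0 !add0r mulr1 => r0.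
have := ipE y; have := ipE x; rewrite r0 nx ny (ipC y x) !mulr0 !addr0 => Ex Ey.
split=> //.
  transitivity (G * ((p * ip x x + q * ip x y) * ip y y
      - (p * ip x y + q * ip y y) * ip x y)
      + p * (1 - G * (ip x x * ip y y - ip x y ^+ 2))); first by ring.
  by rewrite Ex Ey gram; ring.
transitivity (G * ((p * ip x y + q * ip y y) * ip x x
      - (p * ip x x + q * ip x y) * ip x y)
      + q * (1 - G * (ip x x * ip y y - ip x y ^+ 2))); first by ring.
by rewrite Ex Ey gram; ring.
Qed.

End Frame.

Section SurfaceEquations.
Variables (A : comNzRingType) (d1 d2 : derivation A).
Hypothesis two_reg : forall f : A, f + f = 0 -> f = 0.
Hypothesis d21 : forall f, d2 (d1 f) = d1 (d2 f).
Variables (X n : 'I_3 -> A) (G : A).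

Definition vder (d : derivation A) (Y : 'I_3 -> A) c := d (Y c).

Definition first_coef (d e : derivation A) := ip (vder d X) (vder e X).
Definition second_coef (d e : derivation A) := - ip (vder d (vder e X)) n.

Local Notation g11 := (first_coef d1 d1).
Local Notation g12 := (first_coef d1 d2).
Local Notation g22 := (first_coef d2 d2).
Local Notation h11 := (second_coef d1 d1).
Local Notation h12 := (second_coef d1 d2).
Local Notation h22 := (second_coef d2 d2).

Hypothesis frame : moving_frame (vder d1 X) (vder d2 X) n G.

Definition tan1 (Y : 'I_3 -> A) :=
  G * (ip Y (vder d1 X) * g22 - ip Y (vder d2 X) * g12).
Definition tan2 (Y : 'I_3 -> A) :=
  G * (ip Y (vder d2 X) * g11 - ip Y (vder d1 X) * g12).

Definition shape11 := G * (h11 * g22 - h12 * g12).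
Definition shape12 := G * (h12 * g11 - h11 * g12).
Definition shape21 := G * (h12 * g22 - h22 * g12).
Definition shape22 := G * (h22 * g11 - h12 * g12).

Definition chris1 (d e : derivation A) := tan1 (vder d (vder e X)).
Definition chris2 (d e : derivation A) := tan2 (vder d (vder e X)).

Lemma decomp Y c :
  Y c = tan1 Y * vder d1 X c + tan2 Y * vder d2 X c + ip Y n * n c.
Proof. exact: frame_decomp frame Y c. Qed.

Lemma gauss_formula d e c : vder d (vder e X) c =
  chris1 d e * vder d1 X c + chris2 d e * vder d2 X c - second_coef d e * n c.
Proof. by rewrite {1}decomp /second_coef mulNr opprK. Qed.

Lemma vder21 Y c : vder d2 (vder d1 Y) c = vder d1 (vder d2 Y) c.
Proof. exact: d21. Qed.

Lemma eq_ip (Y Z V : 'I_3 -> A) : Y =1 Z -> ip Y V = ip Z V.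
Proof. by move=> E; rewrite /ip !E. Qed.

Lemma second_coefC : second_coef d2 d1 = h12.
Proof. by congr (- _); apply: eq_ip => c; exact: vder21. Qed.

Lemma chris1C : chris1 d2 d1 = chris1 d1 d2.
Proof. by rewrite /chris1 /tan1 !(eq_ip _ (vder21 X)). Qed.

Lemma chris2C : chris2 d2 d1 = chris2 d1 d2.
Proof. by rewrite /chris2 /tan2 !(eq_ip _ (vder21 X)). Qed.

Lemma der_normal d : ip (vder d n) n = 0.
Proof.
have [nn _ _ _] := frame; apply: two_reg.
by rewrite {2}ipC -der_ip nn der1.
Qed.

Lemma der_normal_tan (d e : derivation A) : ip n (vder e X) = 0 ->
   ip (vder d n) (vder e X) = second_coef d e.
Proof.
move=> ne; have : d (ip n (vder e X)) = 0 by rewrite ne der0.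
rewrite der_ip -/(vder d _) => /eqP; rewrite addr_eq0 => /eqP ->.
by rewrite /second_coef ipC.
Qed.

Lemma weingarten1 c :
  vder d1 n c = shape11 * vder d1 X c + shape12 * vder d2 X c.
Proof.
have [nn nx ny gram] := frame.
rewrite {1}decomp der_normal mul0r addr0 /tan1 /tan2 !der_normal_tan //.
Qed.

Lemma weingarten2 c :
  vder d2 n c = shape21 * vder d1 X c + shape22 * vder d2 X c.
Proof.
have [nn nx ny gram] := frame.
rewrite {1}decomp der_normal mul0r addr0 /tan1 /tan2 !der_normal_tan //.
by rewrite second_coefC.
Qed.

Lemma shape_sym : shape11 * g12 + shape12 * g22 = shape21 * g11 + shape22 * g12.
Proof.
by rewrite /shape11 /shape12 /shape21 /shape22; ring.
Qed.

Lemma der_first (d e f : derivation A) :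
  d (first_coef e f) =
    ip (vder d (vder e X)) (vder f X) + ip (vder d (vder f X)) (vder e X).
Proof. by rewrite der_ip ipC [X in _ + X]ipC addrC ipC addrC [X in _ + X]ipC. Qed.

Lemma ip_second (d e : derivation A) (Y : 'I_3 -> A) : ip n Y = 0 ->
  ip (vder d (vder e X)) Y
  = chris1 d e * ip (vder d1 X) Y + chris2 d e * ip (vder d2 X) Y.
Proof.
move=> nY; rewrite (eq_ip _ (gauss_formula d e)).
transitivity (chris1 d e * ip (vder d1 X) Y + chris2 d e * ip (vder d2 X) Y
  - second_coef d e * ip n Y); first by rewrite /ip; ring.
by rewrite nY mulr0 subr0.
Qed.

(** Tangential components of the equality of the mixed derivatives of the
normal. *)
Lemma codazzi :
  d2 shape11 + shape11 * chris1 d1 d2 + shape12 * chris1 d2 d2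
    = d1 shape21 + shape21 * chris1 d1 d1 + shape22 * chris1 d1 d2 /\
  d2 shape12 + shape11 * chris2 d1 d2 + shape12 * chris2 d2 d2
    = d1 shape22 + shape21 * chris2 d1 d1 + shape22 * chris2 d1 d2.
Proof.
have E c : vder d2 (vder d1 n) c = vder d1 (vder d2 n) c by exact: d21.
pose p := d2 shape11 + shape11 * chris1 d1 d2 + shape12 * chris1 d2 d2
  - (d1 shape21 + shape21 * chris1 d1 d1 + shape22 * chris1 d1 d2).
pose q := d2 shape12 + shape11 * chris2 d1 d2 + shape12 * chris2 d2 d2
  - (d1 shape22 + shape21 * chris2 d1 d1 + shape22 * chris2 d1 d2).
pose r := - shape11 * h12 - shape12 * h22 + shape21 * h11 + shape22 * h12.
suff [p0 q0 _] : [/\ p = 0, q = 0 & r = 0].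
  by split; apply/eqP; rewrite -subr_eq0; apply/eqP.
apply: (frame_free frame) => c.
move: (E c); rewrite {1 3}/vder weingarten1 weingarten2.
rewrite !derD (derM _ shape11) (derM _ shape12) (derM _ shape21) (derM _ shape22).
rewrite -!/(vder _ (vder _ X) c) vder21 !gauss_formula => /eqP.
by rewrite -subr_eq0 => /eqP <-; rewrite /p /q /r; ring.
Qed.

(** The only component of the Gauss equation that the identity of Simons uses:
equality of the mixed third derivatives of the position, in the second tangent
direction. *)
Lemma gauss_equation :
  d2 (chris2 d1 d1) + chris1 d1 d1 * chris2 d1 d2 + chris2 d1 d1 * chris2 d2 d2
    - h11 * shape22
  = d1 (chris2 d1 d2) + chris1 d1 d2 * chris2 d1 d1
    + chris2 d1 d2 * chris2 d1 d2 - h12 * shape12.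
Proof.
have E c : vder d2 (vder d1 (vder d1 X)) c = vder d1 (vder d1 (vder d2 X)) c.
  by rewrite /vder !d21.
pose q := d2 (chris2 d1 d1) + chris1 d1 d1 * chris2 d1 d2
    + chris2 d1 d1 * chris2 d2 d2 - h11 * shape22
    - (d1 (chris2 d1 d2) + chris1 d1 d2 * chris2 d1 d1
    + chris2 d1 d2 * chris2 d1 d2 - h12 * shape12).
pose p := d2 (chris1 d1 d1) + chris1 d1 d1 * chris1 d1 d2
    + chris2 d1 d1 * chris1 d2 d2 - h11 * shape21
    - (d1 (chris1 d1 d2) + chris1 d1 d2 * chris1 d1 d1
    + chris2 d1 d2 * chris1 d1 d2 - h12 * shape11).
pose r := - chris1 d1 d1 * h12 - chris2 d1 d1 * h22 - d2 h11
   + chris1 d1 d2 * h11 + chris2 d1 d2 * h12 + d1 h12.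
suff [_ q0 _] : [/\ p = 0, q = 0 & r = 0].
  by apply/eqP; rewrite -subr_eq0; apply/eqP.
apply: (frame_free frame) => c.
move: (E c); rewrite {1 4}/vder !gauss_formula.
rewrite !derB !derD (derM _ (chris1 d1 d1)) (derM _ (chris2 d1 d1)).
rewrite (derM _ (chris1 d1 d2)) (derM _ (chris2 d1 d2)) (derM _ h11) (derM _ h12).
rewrite -!/(vder _ (vder _ X) c) -!/(vder _ n c) vder21.
rewrite !gauss_formula weingarten1 weingarten2 => /eqP.
by rewrite -subr_eq0 => /eqP <-; rewrite /p /q /r; ring.
Qed.

End SurfaceEquations.

(** * Evolution of the shape operator *)

Section Evolution.
Variables (A : comNzRingType) (d1 d2 dt : derivation A).
Hypothesis two_reg : forall f : A, f + f = 0 -> f = 0.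
Hypothesis d21 : forall f, d2 (d1 f) = d1 (d2 f).
Hypothesis dt1 : forall f, dt (d1 f) = d1 (dt f).
Hypothesis dt2 : forall f, dt (d2 f) = d2 (dt f).
Variables (X n : 'I_3 -> A) (G F : A).

Local Notation g11 := (first_coef X d1 d1).
Local Notation g12 := (first_coef X d1 d2).
Local Notation g22 := (first_coef X d2 d2).
Local Notation h11 := (second_coef X n d1 d1).
Local Notation h12 := (second_coef X n d1 d2).
Local Notation h22 := (second_coef X n d2 d2).
Local Notation S11 := (shape11 d1 d2 X n G).
Local Notation S12 := (shape12 d1 d2 X n G).
Local Notation S21 := (shape21 d1 d2 X n G).
Local Notation S22 := (shape22 d1 d2 X n G).
Local Notation ch1 := (chris1 d1 d2 X G).
Local Notation ch2 := (chris2 d1 d2 X G).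

Hypothesis frame : moving_frame (vder d1 X) (vder d2 X) n G.
Hypothesis flow : forall c, dt (X c) = - (F * n c).

(** Components of the gradient of the speed, which is the time derivative of
the normal; see [dt_normal] and [speed_grad_metric]. *)
Definition speed_grad1 := tan1 d1 d2 X G (vder dt n).
Definition speed_grad2 := tan2 d1 d2 X G (vder dt n).
Local Notation V1 := speed_grad1.
Local Notation V2 := speed_grad2.

Lemma ip_dt_normal (d : derivation A) : (forall f, dt (d f) = d (dt f)) ->
  ip n (vder d X) = 0 -> ip (vder dt n) (vder d X) = d F.
Proof.
move=> dtd nd; have [nn nx ny gram] := frame.
have : dt (ip n (vder d X)) = 0 by rewrite nd der0.
rewrite der_ip -!/(vder _ _) => /eqP; rewrite addr_eq0 => /eqP ->.
have dX c : vder dt (vder d X) c = - (d F * n c + F * vder d n c).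
  by rewrite /vder dtd flow derN derM.
rewrite ipC (eq_ip _ dX).
transitivity (d F * ip n n + F * ip (vder d n) n); first by rewrite /ip; ring.
by rewrite nn (der_normal two_reg frame); ring.
Qed.

Lemma dt_normal c : vder dt n c = V1 * vder d1 X c + V2 * vder d2 X c.
Proof.
by rewrite {1}(decomp frame) (der_normal two_reg frame) mul0r addr0.
Qed.

Lemma speed_grad_metric :
  V1 * g11 + V2 * g12 = d1 F /\ V1 * g12 + V2 * g22 = d2 F.
Proof.
have [nn nx ny gram] := frame.
rewrite /V1 /V2 /tan1 /tan2 !ip_dt_normal //.
by split; rewrite -[RHS]mul1r -gram /first_coef; ring.
Qed.

(** Diagonal entries of dS/dt = Hess F + F S^2, obtained by exchanging the
time derivative and the space derivatives of the normal. *)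
Lemma shape_evolution :
  dt S11 = d1 V1 + V1 * ch1 d1 d1 + V2 * ch1 d1 d2 + F * (S11 ^+ 2 + S12 * S21)
  /\
  dt S22 = d2 V2 + V1 * ch2 d1 d2 + V2 * ch2 d2 d2 + F * (S21 * S12 + S22 ^+ 2).
Proof.
have dtX (d : derivation A) : (forall f, dt (d f) = d (dt f)) -> forall c,
    vder dt (vder d X) c = - (d F * n c + F * vder d n c).
  by move=> dtd c; rewrite /vder dtd flow derN derM.
have E1 c : vder dt (vder d1 n) c = vder d1 (vder dt n) c by exact: dt1.
have E2 c : vder dt (vder d2 n) c = vder d2 (vder dt n) c by exact: dt2.
(* p, q and r are the coefficients, on the two tangent vectors and on the
   normal, of the equality of the mixed derivatives of the normal. *)
pose p1 := dt S11 - (d1 V1 + V1 * ch1 d1 d1 + V2 * ch1 d1 d2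
  + F * (S11 ^+ 2 + S12 * S21)).
pose q1 := dt S12 - (d1 V2 + V1 * ch2 d1 d1 + V2 * ch2 d1 d2
  + F * (S11 * S12 + S12 * S22)).
pose r1 := - S11 * d1 F - S12 * d2 F + V1 * h11 + V2 * h12.
pose p2 := dt S21 - (d2 V1 + V1 * ch1 d1 d2 + V2 * ch1 d2 d2
  + F * (S21 * S11 + S22 * S21)).
pose q2 := dt S22 - (d2 V2 + V1 * ch2 d1 d2 + V2 * ch2 d2 d2
  + F * (S21 * S12 + S22 ^+ 2)).
pose r2 := - S21 * d1 F - S22 * d2 F + V1 * h12 + V2 * h22.
split; apply/eqP; rewrite -subr_eq0; apply/eqP.
  suff [] : [/\ p1 = 0, q1 = 0 & r1 = 0] by [].
  apply: (frame_free frame) => c; move: (E1 c).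
  rewrite {1 3}/vder (weingarten1 two_reg frame) dt_normal !derD.
  rewrite (derM _ S11) (derM _ S12) (derM _ V1) (derM _ V2).
  rewrite -!/(vder _ (vder _ X) c) !dtX //.
  rewrite !(gauss_formula frame) (weingarten1 two_reg frame).
  rewrite (weingarten2 two_reg d21 frame) => /eqP.
  by rewrite -subr_eq0 => /eqP <-; rewrite /p1 /q1 /r1; ring.
suff [] : [/\ p2 = 0, q2 = 0 & r2 = 0] by [].
apply: (frame_free frame) => c; move: (E2 c).
rewrite {1 3}/vder (weingarten2 two_reg d21 frame) dt_normal !derD.
rewrite (derM _ S21) (derM _ S22) (derM _ V1) (derM _ V2).
rewrite -!/(vder _ (vder _ X) c) !dtX // (vder21 d21).
rewrite !(gauss_formula frame) (weingarten1 two_reg frame).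
rewrite (weingarten2 two_reg d21 frame) => /eqP.
by rewrite -subr_eq0 => /eqP <-; rewrite /p2 /q2 /r2; ring.
Qed.

End Evolution.

(** * The identity of Simons *)

Section Evaluation.
Variables (A : comNzRingType) (R : realFieldType) (ev : {rmorphism A -> R}).

Definition evE := (rmorph0, rmorph1, rmorph_nat, rmorphB, rmorphD, rmorphN,
  rmorphM, rmorphXn).

Lemma rmorph_pinchHJ_dH x y : ev (pinchHJ_dH x y) = pinchHJ_dH (ev x) (ev y).
Proof. by rewrite /pinchHJ_dH !evE. Qed.
Lemma rmorph_pinchHJ_dK x y : ev (pinchHJ_dK x y) = pinchHJ_dK (ev x) (ev y).
Proof. by rewrite /pinchHJ_dK !evE. Qed.
Lemma rmorph_pinchHJ_hess x y z t :
  ev (pinchHJ_hess x y z t) = pinchHJ_hess (ev x) (ev y) (ev z) (ev t).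
Proof. by rewrite /pinchHJ_hess
    /pinchHJ_dHH /pinchHJ_dHK /pinchHJ_dKK !evE. Qed.

Lemma ev_der_pinchHJ (d : derivation A) H K J : K * J = 1 ->
  ev (d (pinchHJ H J)) =
  pinchHJ_dH (ev H) (ev J) * ev (d H) + pinchHJ_dK (ev H) (ev J) * ev (d K).
Proof.
move=> KJ; rewrite (der_pinchHJ _ _ KJ) rmorphD !rmorphM.
by rewrite rmorph_pinchHJ_dH rmorph_pinchHJ_dK.
Qed.

Lemma ev_der_der_pinchHJ (d : derivation A) H K J : K * J = 1 ->
  ev (d (d (pinchHJ H J))) =
  pinchHJ_dH (ev H) (ev J) * ev (d (d H)) + pinchHJ_dK (ev H) (ev J) * ev (d (d K))
  + pinchHJ_hess (ev H) (ev J) (ev (d H)) (ev (d K)).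
Proof.
move=> KJ; rewrite (der_der_pinchHJ _ _ KJ) rmorphD rmorphD !rmorphM.
by rewrite rmorph_pinchHJ_dH rmorph_pinchHJ_dK rmorph_pinchHJ_hess.
Qed.

End Evaluation.

(** S is the shape operator, g the metric, h the second fundamental form, and
p and q are the Christoffel symbols with upper index 1 and 2.  The morphism ev
is the evaluation at a point where d1 and d2 are orthonormal principal
directions, with principal curvatures a and b.  The entries are variables, so
that rewriting with the Leibniz rule stops at them. *)
Section AtPoint.
Variables (A : comNzRingType) (R : realFieldType) (ev : {rmorphism A -> R}).
Variables (d1 d2 dt : derivation A).
Hypothesis d21 : forall f, d2 (d1 f) = d1 (d2 f).
Variables (S11 S12 S21 S22 g11 g12 g22 h11 h12 : A).
Variables (p11 p12 p22 q11 q12 q22 : A) (a b : R).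

Hypothesis codazzi1 :
  d2 S11 + S11 * p12 + S12 * p22 = d1 S21 + S21 * p11 + S22 * p12.
Hypothesis codazzi2 :
  d2 S12 + S11 * q12 + S12 * q22 = d1 S22 + S21 * q11 + S22 * q12.
Hypothesis sym : S11 * g12 + S12 * g22 = S21 * g11 + S22 * g12.
Hypothesis gauss : d2 q11 + p11 * q12 + q11 * q22 - h11 * S22
  = d1 q12 + p12 * q11 + q12 * q12 - h12 * S12.
Hypothesis d1g11 : d1 g11 = 2 * (p11 * g11 + q11 * g12).
Hypothesis d2g11 : d2 g11 = 2 * (p12 * g11 + q12 * g12).
Hypothesis d1g12 : d1 g12 = p11 * g12 + q11 * g22 + p12 * g11 + q12 * g12.
Hypothesis d2g12 : d2 g12 = p12 * g12 + q12 * g22 + p22 * g11 + q22 * g12.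
Hypothesis d1g22 : d1 g22 = 2 * (p12 * g12 + q12 * g22).
Hypothesis d2g22 : d2 g22 = 2 * (p22 * g12 + q22 * g22).
Hypotheses (eg11 : ev g11 = 1) (eg12 : ev g12 = 0) (eg22 : ev g22 = 1).
Hypotheses (eS11 : ev S11 = a) (eS12 : ev S12 = 0).
Hypotheses (eS21 : ev S21 = 0) (eS22 : ev S22 = b).
Hypotheses (eh11 : ev h11 = a) (eh12 : ev h12 = 0).

Definition vals := (eg11, eg12, eg22, eS11, eS12, eS21, eS22, eh11, eh12).
Definition dg := (d1g11, d2g11, d1g12, d2g12, d1g22, d2g22).

Let H := S11 + S22.
Let K := S11 * S22 - S12 * S21.

Lemma gaussK_der (d : derivation A) :
  ev (d K) = b * ev (d S11) + a * ev (d S22).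
Proof. by rewrite /K !derE !evE !vals; ring. Qed.

Lemma gaussK_der_der (d : derivation A) :
  ev (d (d K)) = b * ev (d (d S11)) + a * ev (d (d S22))
    + 2 * (ev (d S11) * ev (d S22) - ev (d S12) * ev (d S21)).
Proof. by rewrite /K !derE !evE !vals; ring. Qed.

(** The Laplacian of the determinant K of the shape operator S compared with
tr (cof(S) Hess (tr S)), in orthonormal principal directions.  The two differ
by (b - a) (S11_22 - S22_11) up to first derivatives.  The Codazzi equations
turn this difference into an antisymmetrised derivative, which the symmetry
of the second fundamental form and the Gauss equation express by the
curvature. *)
Lemma simons :
  let x1 := ev (d1 S11) in let y1 := ev (d1 S22) in
  let x2 := ev (d2 S11) in let y2 := ev (d2 S22) in
  let hs1 := ev (d1 (d1 H)) - ev p11 * ev (d1 H) - ev q11 * ev (d2 H) in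
  let hs2 := ev (d2 (d2 H)) - ev p22 * ev (d1 H) - ev q22 * ev (d2 H) in
  ev (d1 (d1 K)) + ev (d2 (d2 K))
    - (ev p11 + ev p22) * ev (d1 K) - (ev q11 + ev q22) * ev (d2 K)
  = b * hs1 + a * hs2 - (a - b) ^+ 2 * (a * b)
    + 2 * (x1 * y1 + x2 * y2 - x2 ^+ 2 - y1 ^+ 2).
Proof.
move=> x1 y1 x2 y2 hs1 hs2; rewrite {}/hs1 {}/hs2 !gaussK_der !gaussK_der_der.
rewrite /H !derD !evE.
have c1 := congr1 ev codazzi1; have c2 := congr1 ev codazzi2.
have c12 := congr1 (fun f => ev (d2 f)) codazzi1.
have c21 := congr1 (fun f => ev (d1 f)) codazzi2.
have s1 := congr1 (fun f => ev (d1 f)) sym.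
have s2 := congr1 (fun f => ev (d2 f)) sym.
(* Differentiating along d1 first produces d2 q11, which the Gauss equation
   expresses by d1 q12. *)
have s12 := congr1 d1 sym; rewrite !(derE, dg) in s12.
have {}s12 := congr1 (fun f => ev (d2 f)) s12.
have g := congr1 ev gauss.
rewrite !(derB, derD, derM, der_nat, dg) in c12 c21 s1 s2 s12.
rewrite !(rmorphB, rmorphD, rmorphM, rmorph_nat, rmorph0, vals, d21) /=
  in c1 c2 c12 c21 s1 s2 s12 g.
rewrite /x1 /y1 /x2 /y2 in c1 c2 c12 c21 s1 s2 s12 g *.
have e1 : ev (d1 S21) = ev (d2 S11) + (a - b) * ev p12 by lra.
have e2 : ev (d2 S12) = ev (d1 S22) - (a - b) * ev q12 by lra.
have e3 : ev (d1 S12) = ev (d1 S21) - (a - b) * (ev q11 + ev p12) by lra.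
have e4 : ev (d2 S21) = ev (d2 S12) + (a - b) * (ev q12 + ev p22) by lra.
have e5 : ev (d2 q11) = ev (d1 q12) + ev p12 * ev q11 + ev q12 ^+ 2
   - ev p11 * ev q12 - ev q11 * ev q22 + a * b by lra.
rewrite !(e3, e4, e1, e2, e5) in c12 c21 s12 *.
(* The difference of the two sides is b - a times the sum of the
   differentiated Codazzi equations minus the differentiated symmetry. *)
have lincomb (L M L1 M1 L2 M2 L3 M3 : R) : L1 = M1 -> L2 = M2 -> L3 = M3 ->
    L - M = (b - a) * (L1 - M1 + (L2 - M2) - (L3 - M3)) -> L = M.
  by move=> -> -> ->; rewrite !subrr addr0 subr0 mulr0 => /subr0_eq.
by apply: (lincomb _ _ _ _ _ _ _ _ c12 c21 s12); ring.
Qed.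

Variables (V1 V2 J : A).
Hypothesis dt_S11 : dt S11
  = d1 V1 + V1 * p11 + V2 * p12 + H ^+ 4 * (S11 ^+ 2 + S12 * S21).
Hypothesis dt_S22 : dt S22
  = d2 V2 + V1 * q12 + V2 * q22 + H ^+ 4 * (S21 * S12 + S22 ^+ 2).
Hypothesis V_1 : V1 * g11 + V2 * g12 = d1 (H ^+ 4).
Hypothesis V_2 : V1 * g12 + V2 * g22 = d2 (H ^+ 4).
Hypothesis KJ : K * J = 1.
Hypotheses (a0 : 0 < a) (b0 : 0 < b) (ab : a != b).

(** Reduction to [pinching_reaction_le0]: V is the gradient of the speed, and
its derivative is the Hessian of the speed. *)
Lemma at_point_pinching_der_time_le0 :
  ev (d1 (pinchHJ H J)) = 0 -> ev (d2 (pinchHJ H J)) = 0 ->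
  ev (d1 (d1 (pinchHJ H J))) <= 0 -> ev (d2 (d2 (pinchHJ H J))) <= 0 ->
  ev (dt (pinchHJ H J)) <= 0.
Proof.
have eH : ev H = a + b by rewrite rmorphD eS11 eS22.
have eK : ev K = a * b by rewrite rmorphB !rmorphM /= !vals mul0r subr0.
have eJ : ev J = (a * b)^-1.
  have ab0 : a * b != 0 by rewrite mulf_neq0 ?gt_eqF.
  by apply: (mulfI ab0); rewrite -eK -rmorphM KJ rmorph1 eK mulfV.
rewrite !(ev_der_der_pinchHJ ev _ _ KJ) !(ev_der_pinchHJ ev _ _ KJ) eH eJ.
rewrite !gaussK_der => crit1 crit2 le1 le2.
have sim := simons.
have eV1 := congr1 ev V_1; have eV2 := congr1 ev V_2.
have eV11 := congr1 (fun f => ev (d1 f)) V_1.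
have eV22 := congr1 (fun f => ev (d2 f)) V_2.
have et11 := congr1 ev dt_S11; have et22 := congr1 ev dt_S22.
rewrite !(derX, derM, derD, dg, der_nat, evE, vals) /= in eV1 eV2 eV11 eV22 et11 et22.
have evdH (d : derivation A) : ev (d H) = ev (d S11) + ev (d S22).
  by rewrite /H derD rmorphD.
have evddH (d : derivation A) : ev (d (d H)) = ev (d (d S11)) + ev (d (d S22)).
  by rewrite /H !derD rmorphD.
rewrite /= !(gaussK_der, evdH, evddH) in sim crit1 crit2 le1 le2 *.
rewrite ?(mulr0, mulr1, mul0r, addr0, add0r) in eV1 eV2 eV11 eV22 et11 et22.
rewrite eV1 eV2 in eV11 eV22 et11 et22.
have edV1 : ev (d1 V1) = 12 * (a + b) ^+ 2 * (ev (d1 S11) + ev (d1 S22)) ^+ 2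
  + 4 * (a + b) ^+ 3 * (ev (d1 (d1 S11)) + ev (d1 (d1 S22))
    - 2 * (ev (d1 S11) + ev (d1 S22)) * ev p11
    - (ev (d2 S11) + ev (d2 S22)) * (ev q11 + ev p12)) by lra.
have edV2 : ev (d2 V2) = 12 * (a + b) ^+ 2 * (ev (d2 S11) + ev (d2 S22)) ^+ 2
  + 4 * (a + b) ^+ 3 * (ev (d2 (d2 S11)) + ev (d2 (d2 S22))
    - 2 * (ev (d2 S11) + ev (d2 S22)) * ev q22
    - (ev (d1 S11) + ev (d1 S22)) * (ev q12 + ev p22)) by lra.
have T := (fun Ht Kt e1 e2 =>
  @pinching_reaction_le0 _ _ _ _ _ _ _ _ _ _ Ht Kt a0 b0 ab sim e1 e2 crit1 crit2).
apply: T.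
- by rewrite et11 et22 edV1 edV2; ring.
- by rewrite et11 et22 edV1 edV2; ring.
- move: crit1 crit2 le1 le2.
  set w1 := pinchHJ_dH _ _; set w2 := pinchHJ_dK _ _ => crit1 crit2 le1 le2.
  (* The Laplacian is the sum of the second derivatives minus Christoffel
     terms proportional to the first derivatives, which vanish. *)
  rewrite [leLHS](_ : _ =
    (w1 * (ev (d1 (d1 S11)) + ev (d1 (d1 S22))) + w2 * ev (d1 (d1 K)) +
      pinchHJ_hess (a + b) (a * b)^-1 (ev (d1 S11) + ev (d1 S22))
        (b * ev (d1 S11) + a * ev (d1 S22)))
    + (w1 * (ev (d2 (d2 S11)) + ev (d2 (d2 S22))) + w2 * ev (d2 (d2 K)) +
      pinchHJ_hess (a + b) (a * b)^-1 (ev (d2 S11) + ev (d2 S22))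
        (b * ev (d2 S11) + a * ev (d2 S22)))
    - (ev p11 + ev p22) * (w1 * (ev (d1 S11) + ev (d1 S22))
        + w2 * (b * ev (d1 S11) + a * ev (d1 S22)))
    - (ev q11 + ev q22) * (w1 * (ev (d2 S11) + ev (d2 S22))
        + w2 * (b * ev (d2 S11) + a * ev (d2 S22)))); last by ring.
  by rewrite crit1 crit2 !mulr0 !subr0 -[leRHS]addr0 lerD.
Qed.
End AtPoint.

Section Conclusion.
Variables (A : comNzRingType) (R : realFieldType) (ev : {rmorphism A -> R}).
Variables (d1 d2 dt : derivation A).
Hypothesis two_reg : forall f : A, f + f = 0 -> f = 0.
Hypothesis d21 : forall f, d2 (d1 f) = d1 (d2 f).
Hypothesis dt1 : forall f, dt (d1 f) = d1 (dt f).
Hypothesis dt2 : forall f, dt (d2 f) = d2 (dt f).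
Variables (X n : 'I_3 -> A) (G J : A).

Definition mean_curv :=
  shape11 d1 d2 X n G + shape22 d1 d2 X n G.
Definition gauss_curv :=
  shape11 d1 d2 X n G * shape22 d1 d2 X n G
  - shape12 d1 d2 X n G * shape21 d1 d2 X n G.

Local Notation H := mean_curv.
Local Notation K := gauss_curv.

Hypothesis frame : moving_frame (vder d1 X) (vder d2 X) n G.
Hypothesis flow : forall c, dt (X c) = - (H ^+ 4 * n c).
Hypothesis KJ : K * J = 1.

Variables (a b : R).
Hypotheses (a0 : 0 < a) (b0 : 0 < b) (ab : a != b).
Hypotheses (eg11 : ev (first_coef X d1 d1) = 1).
Hypotheses (eg12 : ev (first_coef X d1 d2) = 0).
Hypotheses (eg22 : ev (first_coef X d2 d2) = 1).
Hypotheses (eh11 : ev (second_coef X n d1 d1) = a).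
Hypotheses (eh12 : ev (second_coef X n d1 d2) = 0).
Hypotheses (eh22 : ev (second_coef X n d2 d2) = b).

(** At a spatial maximum of the pinching function at which d1 and d2 are
orthonormal principal directions with distinct principal curvatures, the time
derivative is nonpositive. *)
Lemma pinching_der_time_le0 :
  ev (d1 (pinchHJ H J)) = 0 -> ev (d2 (pinchHJ H J)) = 0 ->
  ev (d1 (d1 (pinchHJ H J))) <= 0 -> ev (d2 (d2 (pinchHJ H J))) <= 0 ->
  ev (dt (pinchHJ H J)) <= 0.
Proof.
have [nn nx ny gram] := frame.
have eG : ev G = 1.
  have := congr1 ev gram; rewrite -!/(first_coef _ _ _).
  rewrite rmorph1 rmorphM rmorphB rmorphM rmorphXn /= eg11 eg12 eg22.
  by rewrite expr0n /= subr0 !mulr1.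
have eS11 : ev (shape11 d1 d2 X n G) = a.
  rewrite rmorphM rmorphB !rmorphM /= eg22 eh11 eh12 eG; ring.
have eS12 : ev (shape12 d1 d2 X n G) = 0.
  rewrite rmorphM rmorphB !rmorphM /= eg11 eg12 eh12 eG; ring.
have eS21 : ev (shape21 d1 d2 X n G) = 0.
  rewrite rmorphM rmorphB !rmorphM /= eg12 eg22 eh12 eG; ring.
have eS22 : ev (shape22 d1 d2 X n G) = b.
  rewrite rmorphM rmorphB !rmorphM /= eg11 eh12 eh22 eG; ring.
have [cod1 cod2] := codazzi two_reg d21 frame.
have sym := shape_sym d1 d2 X n G.
have gauss := gauss_equation two_reg d21 frame.
have metric (d e f : derivation A) : ip n (vder e X) = 0 -> ip n (vder f X) = 0 ->
    d (first_coef X e f) =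
    chris1 d1 d2 X G d e * first_coef X d1 f + chris2 d1 d2 X G d e * first_coef X d2 f
  + (chris1 d1 d2 X G d f * first_coef X d1 e
    + chris2 d1 d2 X G d f * first_coef X d2 e).
  by move=> ne nf; rewrite der_first !(ip_second frame).
have g21 : first_coef X d2 d1 = first_coef X d1 d2 by exact: ipC.
have p21 := chris1C d21 X G; have q21 := chris2C d21 X G.
have d1g11 := metric d1 d1 d1 nx nx; have d2g11 := metric d2 d1 d1 nx nx.
have d1g12 := metric d1 d1 d2 nx ny; have d2g12 := metric d2 d1 d2 nx ny.
have d1g22 := metric d1 d2 d2 ny ny; have d2g22 := metric d2 d2 d2 ny ny.
rewrite ?(g21, p21, q21) in d1g11 d2g11 d1g12 d2g12 d1g22 d2g22.
have [v1 v2] := speed_grad_metric two_reg dt1 dt2 frame flow.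
have [t11 t22] := shape_evolution two_reg d21 dt1 dt2 frame flow.
have twice (x : A) : x + x = 2 * x by rewrite mulr_natl mulr2n.
rewrite !twice in d1g11 d2g11 d1g22 d2g22.
rewrite addrA in d1g12; rewrite addrA in d2g12.
exact: (at_point_pinching_der_time_le0 d21 cod1 cod2 sym gauss d1g11 d2g11 d1g12
  d2g12 d1g22 d2g22 eg11 eg12 eg22 eS11 eS12 eS21 eS22 eh11 eh12 t11 t22 v1 v2
  KJ a0 b0 ab).
Qed.
End Conclusion.

(** * Functions of class C^k *)

Section CkTheory.
Variables (R : realType) (V : normedModType R).
Implicit Types (U : set V).

(** The expansion of g at x is that of f. *)
Lemma near_eq_differentiable (W : normedModType R) (f g : V -> W) x :
  (\near x, f x = g x) -> differentiable f x -> differentiable g x.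
Proof.
move=> fg df; have fgx := nbhs_singleton fg.
have gE : g \o shift x = cst (g x) + 'd f x +o_ 0 id.
  apply/eqaddoP => e e0.
  have /eqaddoP/(_ e e0) := diff_locally df.
  have : \forall h \near (0 : V), f (h + x) = g (h + x).
    rewrite (near_shift x 0) /= sub0r; apply: filterS fg => y fgy.
    by rewrite /= subrK.
  apply: filterS2 => h; rewrite !fctE /= fgx => -> ; exact.
apply/diff_locallyP; rewrite (diff_unique (diff_continuous df) gE).
by split; [exact: diff_continuous | exact: gE].
Qed.

Lemma Ck_eq (W : normedModType R) k U (f g : V -> W) : open U ->
  (forall x, U x -> f x = g x) -> Ck k U f -> Ck k U g.
Proof.
move=> oU; elim: k f g => [|k IH] f g fg /=.
  move=> cf x Ux; have fgx : \forall y \near x, f y = g y.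
    by apply: filterS (open_nbhs_nbhs (conj oU Ux)) => y /fg.
  apply: (@cvg_trans _ (f @ x)); last by rewrite -fg //; exact: cf.
  by apply: near_eq_cvg; apply: filterS fgx => y ->.
move=> [df cf]; split.
  move=> x Ux; have fgx : \forall y \near x, f y = g y.
    by apply: filterS (open_nbhs_nbhs (conj oU Ux)) => y /fg.
  exact: near_eq_differentiable fgx (df _ Ux).
move=> v; apply: (IH ('D_v f)) => // x Ux; apply: near_eq_derive.
by apply: filterS (open_nbhs_nbhs (conj oU Ux)) => y /fg.
Qed.

Lemma Ck_sub (W : normedModType R) k U U' (f : V -> W) :
  U' `<=` U -> Ck k U f -> Ck k U' f.
Proof.
move=> sU; elim: k f => [|k IH] f /=; first by move=> cf x /sU; exact: cf.
by move=> [df cf]; split; [move=> x /sU; exact: df | move=> v; exact: IH].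
Qed.

Lemma CkS (W : normedModType R) k U (f : V -> W) : Ck k.+1 U f -> Ck k U f.
Proof.
elim: k f => [|k IH] f; first by move=> [df _] x /df /differentiable_continuous.
by move=> [df cf]; split => // v; exact: IH.
Qed.

Lemma Ck_cst (W : normedModType R) k U (c : W) : Ck k U (cst c).
Proof.
elim: k c => [|k IH] c /=; first by move=> x _; exact: cvg_cst.
split=> // v; have -> : (fun x : V => 'D_v (cst c) x) = cst 0.
  by apply/funext => x; exact: derive_cst.
exact: IH.
Qed.

Lemma CkD k U (f g : V -> R) : open U ->
  Ck k U f -> Ck k U g -> Ck k U (f \+ g).
Proof.
move=> oU; elim: k f g => [|k IH] f g /=.
  by move=> cf cg x Ux; apply: continuousD; [exact: cf | exact: cg].
move=> [df cf] [dg cg]; split.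
  by move=> x Ux; apply: differentiableD; [exact: df | exact: dg].
move=> v; apply: Ck_eq (IH _ _ (cf v) (cg v)) => // x Ux.
by rewrite /= deriveD //; apply: diff_derivable; [exact: df | exact: dg].
Qed.

Lemma CkM k U (f g : V -> R) : open U ->
  Ck k U f -> Ck k U g -> Ck k U (f \* g).
Proof.
move=> oU; elim: k f g => [|k IH] f g.
  by move=> cf cg x Ux; apply: continuousM; [exact: cf | exact: cg].
move=> cf1 cg1; have [df cf] := cf1; have [dg cg] := cg1.
have cf0 := CkS cf1; have cg0 := CkS cg1.
split.
  by move=> x Ux; apply: differentiableM; [exact: df | exact: dg].
move=> v; have := CkD oU (IH _ _ cf0 (cg v)) (IH _ _ cg0 (cf v)).
apply: Ck_eq => // x Ux.
by rewrite /= deriveM //; apply: diff_derivable; [exact: df | exact: dg].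
Qed.

Lemma CkN k U (f : V -> R) : open U -> Ck k U f -> Ck k U (\- f).
Proof.
move=> oU cf; have := CkM oU (Ck_cst k U (-1 : R)) cf.
by apply: Ck_eq => // x Ux /=; rewrite mulN1r.
Qed.

Lemma CkV k U (f : V -> R) : open U -> (forall x, U x -> f x != 0) ->
  Ck k U f -> Ck k U (fun x => (f x)^-1).
Proof.
move=> oU f0; elim: k => [|k IH].
  by move=> cf x Ux; apply: continuousV; [exact: f0 | exact: cf].
move=> cf1; have [df cf] := cf1; have cV := IH (CkS cf1).
split.
  by move=> x Ux; apply: differentiableV; [exact: df | exact: f0].
move=> v; have := CkN oU (CkM oU (CkM oU cV cV) (cf v)).
apply: Ck_eq => // x Ux.
rewrite /= (@deriveV _ _ f) ?f0 //; last by apply: diff_derivable; exact: df.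
by rewrite -mulNr -expr2 exprVn.
Qed.

(** By induction, since the derivative of the square root of f is
(sqrt f / (2 f)) times the derivative of f. *)
Lemma Ck_sqrt k U (f : V -> R) : open U -> (forall x, U x -> 0 < f x) ->
  Ck k U f -> Ck k U (fun x => Num.sqrt (f x)).
Proof.
move=> oU f0; elim: k => [|k IH].
  move=> cf x Ux; apply: continuous_comp; first exact: cf.
  exact: sqrt_continuous.
move=> cf1; have [df cf] := cf1; have cS := IH (CkS cf1).
have dsqrt x : U x -> differentiable (fun x => Num.sqrt (f x)) x.
  move=> Ux; apply: differentiable_comp; first exact: df.
  by apply/derivable1_diffP; have [] := is_derive1_sqrt (f0 _ Ux).
split=> // v.
have fn0 x : U x -> 2 * f x != 0 by move=> Ux; rewrite mulf_neq0 // gt_eqF ?f0.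
have cI := CkV oU fn0 (CkM oU (Ck_cst k U (2 : R)) (CkS cf1)).
have := CkM oU (CkM oU cS cI) (cf v).
apply: Ck_eq => // x Ux /=.
have dS := is_derive1_sqrt (f0 _ Ux).
have dSd : differentiable Num.sqrt (f x) by apply/derivable1_diffP; case: dS.
have s0 : Num.sqrt (f x) != 0 by rewrite sqrtr_eq0 -ltNge f0.
have DE : 'D_v (Num.sqrt \o f) x = 'D_v f x * (2 * Num.sqrt (f x))^-1.
  apply: (etrans (deriveE v (dsqrt x Ux))).
  apply: (etrans (congr1 (fun h => h v) (diff_comp (df _ Ux) dSd))).
  apply: (etrans (congr1 (fun h => h _) (deriv1E (@ex_derive _ _ _ _ _ _ _ dS)))).
  by rewrite derive1E (@derive_val _ _ _ _ _ _ _ dS) (deriveE v (df _ Ux)).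
rewrite [RHS]DE [RHS]mulrC; congr (_ * _).
by rewrite -{2}(sqr_sqrtr (ltW (f0 _ Ux))); field.
Qed.

Lemma is_derive_line (W : normedModType R) (f : V -> W) x v (s : R) :
  derivable f (x + s *: v) v ->
  is_derive s 1 (fun s : R => f (x + s *: v)) ('D_v f (x + s *: v)).
Proof.
move=> df; have E : (fun h : R => h^-1 *: (f (h *: v + (x + s *: v)) - f (x + s *: v)))
  = (fun h : R => h^-1 *: (((fun s : R => f (x + s *: v)) \o shift s) (h *: (1 : R)) - f (x + s *: v))).
  apply/funext => h /=; congr (_ *: (f _ - _)).
  by rewrite [h *: 1]mulr1 addrCA scalerDl.
by apply: DeriveDef; rewrite /derivable /derive /= -E.
Qed.

End CkTheory.

Section SmoothClosure.
Variables (R : realType) (V : normedModType R) (U : set V).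
Hypothesis oU : open U.
Implicit Types f g : V -> R.

Lemma smoothD f g : smooth U f -> smooth U g -> smooth U (fun z => f z + g z).
Proof. by move=> sf sg k; exact: CkD. Qed.
Lemma smoothM f g : smooth U f -> smooth U g -> smooth U (fun z => f z * g z).
Proof. by move=> sf sg k; exact: CkM. Qed.
Lemma smoothN f : smooth U f -> smooth U (fun z => - f z).
Proof. by move=> sf k; exact: CkN. Qed.
Lemma smoothB f g : smooth U f -> smooth U g -> smooth U (fun z => f z - g z).
Proof. by move=> sf sg; exact: (smoothD sf (smoothN sg)). Qed.
Lemma smoothC (c : R) : smooth U (fun=> c).
Proof. by move=> k; exact: Ck_cst. Qed.
Lemma smoothX2 f : smooth U f -> smooth U (fun z => f z ^+ 2).
Proof. by move=> sf; exact: (smoothM sf sf). Qed.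
Lemma smoothV f : (forall z, U z -> f z != 0) ->
  smooth U f -> smooth U (fun z => (f z)^-1).
Proof. by move=> f0 sf k; exact: CkV. Qed.
Lemma smooth_sqrt f : (forall z, U z -> 0 < f z) ->
  smooth U f -> smooth U (fun z => Num.sqrt (f z)).
Proof. by move=> f0 sf k; exact: Ck_sqrt. Qed.
Lemma smooth_deriv v f : smooth U f -> smooth U ('D_v f).
Proof. by move=> sf k; have [_] := sf k.+1; exact. Qed.

Lemma smooth_sub (W : normedModType R) U' (h : V -> W) :
  U' `<=` U -> smooth U h -> smooth U' h.
Proof. by move=> s sh k; exact: Ck_sub (sh k). Qed.

Lemma smooth_cont (W : normedModType R) (h : V -> W) z :
  smooth U h -> U z -> {for z, continuous h}.
Proof. by move=> sh; exact: (sh 0%N). Qed.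

End SmoothClosure.

(** * Second derivatives *)

Section Schwarz.
Variables (R : realType) (V : normedModType R).

Lemma MVT_0 (g dg : R -> R) (h : R) : 0 < h ->
  (forall s, 0 <= s <= h -> is_derive s 1 g (dg s)) ->
  exists2 s, 0 < s < h & g h - g 0 = h * dg s.
Proof.
move=> h0 gd.
have [||s] := MVT h0 (f := g) (df := dg).
- by move=> s; rewrite in_itv /= => /andP[/ltW a /ltW b]; apply: gd; rewrite a.
- apply: derivable_within_continuous => s; rewrite in_itv /= => sh.
  by have [] := gd _ sh.
rewrite in_itv /= => sh ->; exists s => //.
by rewrite subr0 mulrC.
Qed.

(** Two applications of the mean value theorem, first along v and then along
w. *)
Lemma second_difference U (f : V -> R) x v w (h : R) : 0 < h ->
  (forall s t, 0 <= s <= h -> 0 <= t <= h -> U (x + s *: v + t *: w)) ->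
  Ck 2 U f ->
  exists s t, [/\ 0 <= s <= h, 0 <= t <= h &
    f (x + h *: v + h *: w) - f (x + h *: w) - (f (x + h *: v) - f x)
    = h ^+ 2 * 'D_w ('D_v f) (x + s *: v + t *: w)].
Proof.
move=> h0 inU [df /(_ v)[dvf _]].
have h00 : 0 <= (0 : R) <= h by rewrite lexx ltW.
have hh : 0 <= h <= h by rewrite lexx ltW.
have inU0 s : 0 <= s <= h -> U (x + s *: v).
  by move=> sh; have := inU s 0 sh h00; rewrite scale0r addr0.
have comm s : x + h *: w + s *: v = x + s *: v + h *: w by rewrite addrAC.
have [|s /andP[/ltW s0 /ltW s1] Es] := @MVT_0 (fun s => f (x + h *: w + s *: v) - f (x + s *: v))
  (fun s => 'D_v f (x + h *: w + s *: v) - 'D_v f (x + s *: v)) h h0.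
  move=> s sh.
  have p1 : derivable f (x + h *: w + s *: v) v.
    by apply/diff_derivable/df; rewrite comm; exact: inU.
  have p2 : derivable f (x + s *: v) v by apply/diff_derivable/df/inU0.
  by have := is_deriveB (is_derive_line p1) (is_derive_line p2).
have [|t /andP[/ltW t0 /ltW t1] Et] := @MVT_0 (fun t => 'D_v f (x + s *: v + t *: w))
  (fun t => 'D_w ('D_v f) (x + s *: v + t *: w)) h h0.
  move=> t th; apply: is_derive_line; apply: diff_derivable; apply/dvf/inU => //.
  by rewrite s0.
exists s, t; split; rewrite ?s0 ?t0 //.
move: Es Et; rewrite !scale0r !addr0 !comm => Es Et.
rewrite expr2 -mulrA -Et -Es; ring.
Qed.

Lemma dist_lt_add (a b c e : R) :
  `|a - c| < e -> `|b - c| < e -> `|a - b| < e + e.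
Proof.
move=> ac bc; rewrite -(subrKA c) (le_lt_trans (ler_normD _ _)) // ltrD //.
by rewrite distrC.
Qed.

(** The second difference over a small parallelogram is symmetric in v and w,
and is h^2 times either mixed derivative at a nearby point. *)
Lemma derive_comm U (f : V -> R) x v w : open U -> U x -> Ck 2 U f ->
  'D_w ('D_v f) x = 'D_v ('D_w f) x.
Proof.
move=> oU Ux cf; apply/eqP; apply/negPn/negP => ne.
pose e := `|'D_w ('D_v f) x - 'D_v ('D_w f) x| / 2.
have e0 : 0 < e by rewrite divr_gt0 // normr_gt0 subr_eq0.
have [_ cv] := cf.
have c1 : {for x, continuous ('D_w ('D_v f))}.
  by have [_ /(_ w) c] := cv v; exact: c.
have c2 : {for x, continuous ('D_v ('D_w f))}.
  by have [_ /(_ v) c] := cv w; exact: c.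
have /nbhs_ballP[r /= r0 br] : nbhs x [set y | [/\ U y,
    `|'D_w ('D_v f) x - 'D_w ('D_v f) y| < e &
    `|'D_v ('D_w f) x - 'D_v ('D_w f) y| < e]].
  have n1 := open_nbhs_nbhs (conj oU Ux).
  have n2 : nbhs x [set y | `|'D_w ('D_v f) x - 'D_w ('D_v f) y| < e].
    by move/cvgrPdist_lt : c1 => /(_ e e0).
  have n3 : nbhs x [set y | `|'D_v ('D_w f) x - 'D_v ('D_w f) y| < e].
    by move/cvgrPdist_lt : c2 => /(_ e e0).
  have n23 := @filterI _ _ (nbhs_filter x) _ _ n2 n3.
  apply: (@filterS _ _ (nbhs_filter x)) (@filterI _ _ (nbhs_filter x) _ _ n1 n23).
  move=> y [p1 [p2 p3]].
  exact: And3 p1 p2 p3.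
(* h is so small that the whole parallelogram spanned by h v and h w at x
   lies in the ball of radius r. *)
pose h := r / (2 * (`|v| + `|w| + 1)).
have D0 : 0 < `|v| + `|w| + 1 by rewrite ltr_wpDl // addr_ge0.
have h0 : 0 < h by rewrite divr_gt0 // mulr_gt0.
have small s t : 0 <= s <= h -> 0 <= t <= h -> ball x r (x + s *: v + t *: w).
  move=> /andP[s0 sh] /andP[t0 th]; rewrite -ball_normE /= opprD addrA opprD.
  rewrite addrA subrr add0r -opprD normrN (le_lt_trans (ler_normD _ _)) //.
  rewrite !normrZ (ger0_norm s0) (ger0_norm t0).
  have : s * `|v| + t * `|w| <= h * (`|v| + `|w|).
    by rewrite mulrDr lerD // ler_wpM2r.
  move=> /le_lt_trans; apply.
  have : h * (`|v| + `|w| + 1) = r / 2.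
    by rewrite /h invfM mulrA -mulrA mulVf ?mulr1 // gt_eqF.
  rewrite mulrDr mulr1 => E; apply: (@lt_trans _ _ (r / 2)).
    by rewrite -E ltrDl.
  by rewrite ltr_pdivrMr // ltr_pMr // ltr1n.
have [|s [t [sh th E1]]] := second_difference (v := v) (w := w) h0 _ cf (x := x).
  by move=> s t sh th; have [] := br _ (small _ _ sh th).
have [|s' [t' [sh' th' E2]]] := second_difference (v := w) (w := v) h0 _ cf (x := x).
  by move=> s' t' sh' th'; rewrite addrAC; have [] := br _ (small _ _ th' sh').
have [_ b1 _] := br _ (small _ _ sh th).
have [_ _ b2] := br _ (small _ _ th' sh').
have swap (y p q : V) : y + p + q = y + q + p by rewrite addrAC.
rewrite swap in E2; rewrite (swap _ (s' *: w)) in E2.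
have cancel (a b c d p q : R) : a - b - (c - d) = h ^+ 2 * p ->
    a - c - (b - d) = h ^+ 2 * q -> p = q.
  move=> Ep Eq; have h2 : h ^+ 2 != 0 by rewrite expf_neq0 // gt_eqF.
  by apply: (mulfI h2); rewrite -Ep -Eq; ring.
have E := cancel _ _ _ _ _ _ E1 E2.
rewrite -E in b2; have := dist_lt_add b1 b2.
by rewrite /e -splitr ltxx.
Qed.

Lemma nbhs_line (P : set V) x v : nbhs x P ->
  exists2 r, 0 < r & forall s : R, `|s| < r -> P (x + s *: v).
Proof.
move=> /nbhs_ballP[e /= e0 be]; exists (e / (`|v| + 1)).
  by rewrite divr_gt0 // ltr_wpDl.
move=> s sr; apply: be; rewrite -ball_normE /= opprD addrA subrr add0r normrN.
rewrite normrZ; have v1 : 0 < `|v| + 1 by rewrite ltr_wpDl.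
move: sr; rewrite ltr_pdivlMr // mulrDr mulr1; apply: le_lt_trans.
by rewrite lerDl.
Qed.

Lemma near_line (P : set V) x v :
  nbhs x P -> \forall s \near (0 : R), P (x + s *: v).
Proof.
move=> /(nbhs_line v)[r r0 Pr]; apply/nbhs_ballP; exists r => // s.
by rewrite /ball /= sub0r normrN => /Pr.
Qed.

(** Only the restriction to the line through x in the direction v matters, so
the maximum is not required in the other directions, in particular not in
time. *)
Lemma derive_local_max U (f : V -> R) x v : open U -> U x -> Ck 2 U f ->
  (\forall s \near (0 : R), f (x + s *: v) <= f x) ->
  'D_v f x = 0 /\ 'D_v ('D_v f) x <= 0.
Proof.
move=> oU Ux [df /(_ v)[dvf /(_ v) cvv]] fmax.
have [r r0 Pr] : exists2 r, 0 < r & forall s : R, `|s| < r ->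
    U (x + s *: v) /\ f (x + s *: v) <= f x.
  have [r1 r10 Ur] := nbhs_line v (open_nbhs_nbhs (conj oU Ux)).
  have /nbhs_ballP[r2 /= r20 fr] := fmax.
  exists (Num.min r1 r2); first by rewrite lt_min r10.
  move=> s; rewrite lt_min => /andP[/Ur Us sr2]; split => //.
  by apply: fr; rewrite -ball_normE /= sub0r normrN.
have dg (s : R) : `|s| < r ->
    is_derive s 1 (fun s : R => f (x + s *: v)) ('D_v f (x + s *: v)).
  by move=> /Pr[Us _]; apply/is_derive_line/diff_derivable/df.
have in_r (s : R) : s \in `](- r), r[ -> `|s| < r by rewrite in_itv /= -ltr_norml.
have D0 : 'D_v f x = 0.
  have rr : - r <= r by rewrite ge0_cp // ltW.
  have z : 0 \in `](- r), r[ by rewrite in_itv /= oppr_lt0 r0.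
  have dm (s : R) : s \in `](- r), r[ -> derivable (fun s : R => f (x + s *: v)) s 1.
    by move=> /in_r/dg[].
  have := derive1_at_max rr dm z; rewrite scale0r addr0.
  have sub : forall s : R, s \in `](- r), r[ -> f (x + s *: v) <= f x.
    by move=> s /in_r/Pr[].
  move=> /(_ sub)[_ <-]; have := dg 0; rewrite normr0 => /(_ r0)[_ ->].
  by rewrite scale0r addr0.
split=> //; rewrite leNgt; apply/negP => pos.
have [e e0 Pe] : exists2 e, 0 < e & forall s : R, `|s| < e ->
    0 < 'D_v ('D_v f) (x + s *: v).
  apply: (@nbhs_line [set y | 0 < 'D_v ('D_v f) y]).
  exact: (cvgr_gt _ (cvv _ Ux)).
pose h := Num.min r e / 2.
have m0 : 0 < Num.min r e by rewrite lt_min r0.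
have h0 : 0 < h by rewrite divr_gt0.
have [hr he] : h < r /\ h < e.
  have : h < Num.min r e by rewrite /h; lra.
  by rewrite lt_min => /andP.
have ab (s : R) : 0 <= s <= h -> `|s| < r /\ `|s| < e.
  move=> /andP[s0 sh]; rewrite ger0_norm //.
  by split; exact: le_lt_trans sh _.
have [|s /andP[s0 sh] Es] := @MVT_0 (fun s => f (x + s *: v))
    (fun s => 'D_v f (x + s *: v)) h h0.
  by move=> s /ab[sr _]; exact: dg.
have [|t /andP[t0 th] Et] := @MVT_0 (fun s => 'D_v f (x + s *: v))
    (fun s => 'D_v ('D_v f) (x + s *: v)) s s0.
  move=> t /andP[t0 ts]; apply: is_derive_line; apply: diff_derivable; apply: dvf.
  have [|/Pr[]//] := ab t; rewrite t0 /=.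
  exact: le_trans ts (ltW sh).
move: Es Et; rewrite !scale0r !addr0 D0 subr0 => Es Et.
have : f (x + h *: v) <= f x by apply: (Pr h _).2; rewrite gtr0_norm.
rewrite -subr_le0 Es Et leNgt => /negP; apply.
have te : `|t| < e by rewrite gtr0_norm //; exact: lt_trans th (lt_trans sh he).
exact: mulr_gt0 h0 (mulr_gt0 s0 (Pe t te)).
Qed.
End Schwarz.

(** * The differential ring of smooth functions on an open set *)

(** The base point makes the ring of smooth functions nontrivial. *)
Record pointed_open (V : topologicalType) := PointedOpen {
  po_set :> set V;
  po_point : V;
  po_open : open po_set;
  po_in : po_set po_point }.

(** Functions vanish outside the open set, so that functions with the same
values on it are equal. *)
Record smfun (R : realType) (V : normedModType R) (D : pointed_open V) := SmoothFun {
  smfun_val :> V -> R;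
  smfun_smooth : smooth (po_set D) smfun_val;
  smfun_out : forall x, ~ po_set D x -> smfun_val x = 0 }.

Section SmoothFunctions.
Variables (R : realType) (V : normedModType R) (D : pointed_open V).
Implicit Types (f g h : smfun D).
Local Notation U := (po_set D).

Lemma smfunP f g : (forall x, U x -> f x = g x) -> f = g.
Proof.
move=> fg; have E : smfun_val f = smfun_val g.
  apply/funext => x; have [Dx|Dx] := pselect (U x); first exact: fg.
  by rewrite !smfun_out.
case: f g E {fg} => f f1 f2 [g g1 g2] /= E; subst g.
by congr SmoothFun; exact: Prop_irrelevance.
Qed.

Definition extend0 (u : V -> R) x := if pselect (U x) then u x else 0.

Lemma extend0_in u x : U x -> extend0 u x = u x.
Proof. by rewrite /extend0; case: pselect. Qed.

Lemma extend0_smooth u : smooth U u -> smooth U (extend0 u).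
Proof.
by move=> su k; apply: Ck_eq (su k) => [|x Dx]; [exact: po_open | rewrite extend0_in].
Qed.

Lemma extend0_out u x : ~ U x -> extend0 u x = 0.
Proof. by rewrite /extend0; case: pselect. Qed.

Definition mk_smfun u (su : smooth U u) : smfun D :=
  SmoothFun (extend0_smooth su) (@extend0_out u).

Lemma mk_smfunE u (su : smooth U u) x : U x -> mk_smfun su x = u x.
Proof. exact: extend0_in. Qed.

Let oU : open U := po_open D.

Definition sadd f g := mk_smfun (smoothD oU (smfun_smooth f) (smfun_smooth g)).
Definition smul f g := mk_smfun (smoothM oU (smfun_smooth f) (smfun_smooth g)).
Definition sopp f := mk_smfun (smoothN oU (smfun_smooth f)).
Definition sconst c := mk_smfun (smoothC U c).
Definition sder (v : V) f := mk_smfun (smooth_deriv v (smfun_smooth f)).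

Lemma saddE f g x : U x -> sadd f g x = f x + g x.
Proof. exact: mk_smfunE. Qed.
Lemma smulE f g x : U x -> smul f g x = f x * g x.
Proof. exact: mk_smfunE. Qed.
Lemma soppE f x : U x -> sopp f x = - f x.
Proof. exact: mk_smfunE. Qed.
Lemma sconstE c x : U x -> sconst c x = c.
Proof. exact: mk_smfunE. Qed.
Let opsE := (saddE, smulE, soppE, sconstE).

HB.instance Definition _ := gen_eqMixin (smfun D).
HB.instance Definition _ := gen_choiceMixin (smfun D).

Fact saddA : associative sadd.
Proof. by move=> f g h; apply: smfunP => x Dx; rewrite !opsE // addrA. Qed.
Fact saddC : commutative sadd.
Proof. by move=> f g; apply: smfunP => x Dx; rewrite !opsE // addrC. Qed.
Fact sadd0 : left_id (sconst 0) sadd.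
Proof. by move=> f; apply: smfunP => x Dx; rewrite !opsE // add0r. Qed.
Fact saddN : left_inverse (sconst 0) sopp sadd.
Proof. by move=> f; apply: smfunP => x Dx; rewrite !opsE // addNr. Qed.
HB.instance Definition _ := GRing.isZmodule.Build (smfun D) saddA saddC sadd0 saddN.

Fact smulA : associative smul.
Proof. by move=> f g h; apply: smfunP => x Dx; rewrite !opsE // mulrA. Qed.
Fact smulC : commutative smul.
Proof. by move=> f g; apply: smfunP => x Dx; rewrite !opsE // mulrC. Qed.
Fact smul1 : left_id (sconst 1) smul.
Proof. by move=> f; apply: smfunP => x Dx; rewrite !opsE // mul1r. Qed.
Fact smulDl : left_distributive smul sadd.
Proof. by move=> f g h; apply: smfunP => x Dx; rewrite !opsE // mulrDl. Qed.
Fact sone_neq0 : sconst 1 != 0.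
Proof.
apply/eqP => /(congr1 (fun f : smfun D => f (po_point D))).
have Dp := po_in D; rewrite !opsE // => /eqP.
by rewrite oner_eq0.
Qed.
HB.instance Definition _ :=
  GRing.Zmodule_isComNzRing.Build (smfun D) smulA smulC smul1 smulDl sone_neq0.

Lemma smfunD f g x : U x -> (f + g) x = f x + g x.
Proof. exact: mk_smfunE. Qed.
Lemma smfunM f g x : U x -> (f * g) x = f x * g x.
Proof. exact: mk_smfunE. Qed.
Lemma smfunN f x : U x -> (- f) x = - f x.
Proof. exact: mk_smfunE. Qed.
Lemma smfun0 x : U x -> (0 : smfun D) x = 0.
Proof. exact: mk_smfunE. Qed.
Lemma smfun1 x : U x -> (1 : smfun D) x = 1.
Proof. exact: mk_smfunE. Qed.

Lemma smfun_two_reg f : f + f = 0 -> f = 0.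
Proof.
move=> ff; apply: smfunP => x Dx; rewrite smfun0 //.
have : (f + f) x = 0 by rewrite ff smfun0.
by rewrite smfunD // => E; lra.
Qed.

Definition seval x & U x := fun f : smfun D => f x.

Section Eval.
Variables (x : V) (Dx : U x).
Local Notation ev := (seval Dx).
Fact seval_additive : zmod_morphism ev.
Proof. by move=> f g; rewrite /seval smfunD // smfunN. Qed.
Fact seval_multiplicative : monoid_morphism ev.
Proof. by split => [|f g]; rewrite /seval ?smfun1 ?smfunM. Qed.
HB.instance Definition _ := GRing.isZmodMorphism.Build _ _ ev seval_additive.
HB.instance Definition _ := GRing.isMonoidMorphism.Build _ _ ev seval_multiplicative.
Definition seval_rmorphism : {rmorphism smfun D -> R} := ev.
End Eval.

Lemma smfun_differentiable f x : U x -> differentiable f x.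
Proof. by move=> Dx; have [df _] := smfun_smooth f 1; exact: df. Qed.

Lemma smfun_continuous f x : U x -> {for x, continuous f}.
Proof. by move=> Dx; apply: differentiable_continuous; exact: smfun_differentiable. Qed.

Lemma derive_in (u u' : V -> R) v x : U x -> (forall y, U y -> u y = u' y) ->
  'D_v u x = 'D_v u' x.
Proof.
move=> Dx E; apply: near_eq_derive.
by apply: filterS (open_nbhs_nbhs (conj (po_open D) Dx)) => y /E.
Qed.

Lemma sderE v f x : U x -> sder v f x = 'D_v f x.
Proof. exact: mk_smfunE. Qed.

Fact sder_add v f g : sder v (f + g) = sder v f + sder v g.
Proof.
apply: smfunP => x Dx; rewrite smfunD // !sderE //.
rewrite -deriveD; [|exact/diff_derivable/smfun_differentiable..].
by apply: derive_in => // y Dy; rewrite smfunD.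
Qed.

Fact sder_mul v f g : sder v (f * g) = sder v f * g + f * sder v g.
Proof.
apply: smfunP => x Dx; rewrite smfunD // !smfunM // !sderE //.
rewrite (@derive_in _ ((f : V -> R) * (g : V -> R))) //; last exact: smfunM.
rewrite deriveM; [|exact/diff_derivable/smfun_differentiable..].
by rewrite addrC; congr (_ + _); rewrite mulrC.
Qed.

Definition sderivation v : derivation (smfun D) :=
  Derivation (sder_add v) (sder_mul v).

Lemma sderivationE v f x : U x -> sderivation v f x = 'D_v f x.
Proof. exact: sderE. Qed.

Lemma sderivation2E v w f x : U x ->
  sderivation v (sderivation w f) x = 'D_v ('D_w f) x.
Proof.
move=> Dx; rewrite (sderivationE _ _ Dx).
by apply: derive_in Dx _ => y; exact: sderivationE.
Qed.

Lemma sder_comm v w f :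
  sderivation v (sderivation w f) = sderivation w (sderivation v f).
Proof.
apply: smfunP => x Dx.
have E1 := sderivation2E v w f Dx.
have E2 := sderivation2E w v f Dx.
have E3 := derive_comm w v (po_open D) Dx (smfun_smooth f 2).
exact: etrans E1 (etrans E3 (esym E2)).
Qed.

End SmoothFunctions.

(** * The maximum principle *)

Section MaximumPrinciple.
Variables (R : realType) (M : topologicalType) (I : set R) (w : M -> R -> R).
Hypothesis M_neq0 : [set: M] !=set0.
Hypothesis M_compact : compact [set: M].
Hypothesis I_convex : forall a b t, I a -> I b -> a <= t <= b -> I t.
Hypothesis w_continuous : forall t, I t -> continuous (w ^~ t).
Hypothesis w_usc : forall x t c, I t -> w x t < c ->
  \forall x' \near x & t' \near within I (nbhs t), w x' t' < c.
Hypothesis w_left : forall x t, I t -> (exists2 r, I r & r < t) ->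
  (forall y, w y t <= w x t) ->
  forall e, 0 < e -> \forall h \near 0^'+, w x t - e * h < w x (t - h).

Lemma max_attained t : I t -> exists x, forall y, w y t <= w x t.
Proof.
move=> It; have wc : {within [set: M], continuous (w ^~ t)}.
  by apply: continuous_subspaceT; exact: w_continuous.
have [x _ xmax] := compact_EVT_max M_neq0 M_compact wc.
by exists x => y; apply: xmax; rewrite inE.
Qed.

(** Compactness turns the pointwise bound into a uniform one. *)
Lemma max_usc t c : I t -> (forall x, w x t < c) ->
  \forall t' \near within I (nbhs t), forall x, w x t' < c.
Proof.
move=> It wc.
have FF : Filter (within I (nbhs t)) by exact: within_filter.
have := (@compact_near_coveringP M setT).1 M_compact R (within I (nbhs t))
  (fun t' x => w x t' < c) FF (fun x _ => w_usc It (wc x)).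
by apply: (@filterS _ _ FF) => t' H x; exact: H.
Qed.

(** If the maximum m increased between a and b, consider the first time s at
which m lies above a line of positive slope e through (b, m b).  A point x
where w(., s) is maximal satisfies w(x, s - h) > w(x, s) - e h for small
h > 0, hence m already lies above the line shortly before s.  The spatial
maxima may jump, so m is only known to be upper semicontinuous, which is
enough for the first time to exist. *)
Lemma max_nonincreasing : exists m : R -> R,
  (forall t, I t -> (exists2 x, m t = w x t & forall y, w y t <= w x t)) /\
  (forall s t, I s -> I t -> s <= t -> m t <= m s).
Proof.
have [x0 _] := M_neq0.
have /choice[X XP] : forall t, exists x, I t -> forall y, w y t <= w x t.
  move=> t; have [It|nIt] := pselect (I t); last by exists x0.
  by have [x xmax] := max_attained It; exists x.
exists (fun t => w (X t) t); split; first by move=> t It; exists (X t) => //; exact: XP.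
set m := fun t => w (X t) t.
move=> a b Ia Ib; rewrite le_eqVlt => /predU1P[->//|ab].
rewrite -/(m a) -/(m b) leNgt; apply/negP => mab.
(* Half of the slope of the chord: the line of slope e through (b, m b) lies
   above m a at a. *)
pose e := (m b - m a) / (2 * (b - a)).
have e0 : 0 < e by rewrite divr_gt0 ?mulr_gt0 ?subr_gt0.
pose c := m b - e * (b - a).
have c_gt : m a < c.
  have -> : c = m b - (m b - m a) / 2.
    by rewrite /c /e; field; rewrite subr_eq0 gt_eqF.
  by move: mab; lra.
pose S := [set t | a <= t <= b /\ c + e * (t - a) <= m t].
have Sb : S b by split; rewrite ?(ltW ab) ?lexx // /c subrK.
have infS : has_inf S by split; [exists b | exists a => t [/andP[]]].
pose s := inf S.
have sl t : S t -> s <= t by move=> St; exact: (ge_inf infS.2 St).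
have as_ : a <= s by apply: lb_le_inf; [exists b | move=> t [/andP[]]].
have sb : s <= b by exact: sl.
have Is : I s by apply: (I_convex Ia Ib); rewrite as_ sb.
have IS t : S t -> I t by move=> [tab _]; exact: (I_convex Ia Ib).
(* Upper semicontinuity puts the infimum s of S in S. *)
have Ss : S s.
  split; first by rewrite as_ sb.
  rewrite leNgt; apply/negP => lt_s.
  have : \forall t' \near within I (nbhs s), forall x, w x t' < c + e * (s - a).
    apply: max_usc => // x; exact: le_lt_trans (XP _ Is x) lt_s.
  rewrite /within /= => /nbhs_ballP[d /= d0 near_s].
  have [t St td] := inf_adherent d0 infS.
  have st := sl _ St.
  have := near_s t; rewrite /ball /= ltr_norml => /(_ _ (IS _ St) (X t)).
  case: St => _ /le_lt_trans St.
  have tb : - d < s - t < d by move: st td d0; rewrite -/s; lra.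
  move=> /(_ tb)/St; rewrite ltrD2l ltr_pM2l // ltrD2r => ts.
  by move: (lt_le_trans ts st); rewrite ltxx.
have a_lt_s : a < s.
  rewrite lt_neqAle as_ andbT; apply/eqP => E; case: Ss => _.
  by rewrite -E subrr mulr0 addr0 leNgt c_gt.
have := w_left Is (ex_intro2 _ _ a Ia a_lt_s) (XP _ Is) e0.
move=> near_h.
have [h [h0 hsa hw]] : exists h, [/\ 0 < h, h < s - a & w (X s) s - e * h < w (X s) (s - h)].
  have n2 : \forall h \near 0^'+, h < s - a by apply: nbhs_right_lt; rewrite subr_gt0.
  have n1 : \forall h \near (0 : R)^'+, 0 < h by exact: nbhs_right_gt.
  have := filter_ex (filterI n1 (filterI n2 near_h)).
  by case=> h [? [? ?]]; exists h.
(* The left derivative at s is less than e, so S extends to the left of s. *)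
have Ssh : S (s - h).
  split; first by move: hsa sb h0; lra.
  have Ish : I (s - h) by apply: (I_convex Ia Ib); move: hsa sb h0; lra.
  apply: le_trans (XP _ Ish (X s)); apply: le_trans (ltW hw).
  by case: Ss => _; rewrite -/(m s); lra.
by have := sl _ Ssh; move: h0; lra.
Qed.

End MaximumPrinciple.

(** * Pairs of quadratic forms in the plane *)

Section TwoByTwo.
Variable R : rcfType.
Implicit Types (B G P S : 'M[R]_2) (a b : R).

Lemma charpoly_trdet S a b : char_poly S = ('X - a%:P) * ('X - b%:P) ->
  \tr S = a + b /\ \det S = a * b.
Proof.
move=> E; split.
  have := @char_poly_trace _ _ S isT; rewrite E.
  have -> : ('X - a%:P) * ('X - b%:P) = 'X^2 - (a + b) *: 'X + (a * b)%:P.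
    by rewrite -!mul_polyC polyCD polyCM; ring.
  rewrite !(coefD, coefB, coefN, coefZ, coefX, coefXn, coefC) /= !mulr1 sub0r addr0.
  by move/oppr_inj.
have := char_poly_det S; rewrite E.
rewrite -horner_coef0 hornerM !hornerXsubC !sub0r mulrNN => ->.
by rewrite -signr_odd /= expr0 mul1r.
Qed.

Lemma sum_ord2 (f : 'I_2 -> R) : \sum_i f i = f 0 + f 1.
Proof.
by rewrite big_ord_recl big_ord_recl big_ord0 addr0; congr (_ + f _); apply: val_inj.
Qed.

Lemma trace2 S : \tr S = S 0 0 + S 1 1.
Proof. by rewrite /mxtrace sum_ord2. Qed.

Lemma det2 S : \det S = S 0 0 * S 1 1 - S 0 1 * S 1 0.
Proof.
rewrite (expand_det_row S 0) sum_ord2 /cofactor /= !det_mx11 !mxE /=.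
rewrite addn0 add0n expr0 expr1 mul1r mulN1r mulrN.
by congr (_ * S _ _ - _ * S _ _); apply: val_inj.
Qed.

Lemma mxsym2 S : S^T = S -> S 1 0 = S 0 1.
Proof. by move=> {1}<-; rewrite mxE. Qed.

(** Trace and determinant of B G^-1 are invariant under a change of frame, and
are computed in the new frame without inverting matrices. *)
Lemma curvature_frame_change B G P a b : P \in unitmx -> G \in unitmx ->
  B^T = B -> G^T = G ->
  char_poly (B *m invmx G) = ('X - a%:P) * ('X - b%:P) ->
  let B' := P *m B *m P^T in let G' := P *m G *m P^T in
  (a + b) * (G' 0 0 * G' 1 1 - G' 0 1 ^+ 2)
    = B' 0 0 * G' 1 1 - 2 * B' 0 1 * G' 0 1 + B' 1 1 * G' 0 0 /\
  (a * b) * (G' 0 0 * G' 1 1 - G' 0 1 ^+ 2) = B' 0 0 * B' 1 1 - B' 0 1 ^+ 2.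
Proof.
move=> Pu Gu Bs Gs /charpoly_trdet[trS detS] B' G'.
pose S' := P *m (B *m invmx G) *m invmx P.
have trS' : \tr S' = a + b by rewrite /S' mxtrace_mulC mulKmx.
have detS' : \det S' = a * b.
  by rewrite /S' det_mulmx [X in X * _]det_mulmx mulrAC -det_mulmx mulmxV // det1 mul1r.
have BE : B' = S' *m G'.
  by rewrite /B' /S' /G' !mulmxA !mulmxKV.
have G'10 : G' 1 0 = G' 0 1.
  by apply: mxsym2; rewrite /G' !trmx_mul trmxK Gs mulmxA.
have B'10 : B' 1 0 = B' 0 1.
  by apply: mxsym2; rewrite /B' !trmx_mul trmxK Bs mulmxA.
have BEe i j : B' i j = S' i 0 * G' 0 j + S' i 1 * G' 1 j.
  by rewrite BE mxE sum_ord2.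
have b00 := BEe 0 0; have b01 := BEe 0 1; have b10 := BEe 1 0; have b11 := BEe 1 1.
rewrite -trS' -detS' trace2 det2; split.
  have -> : 2 * B' 0 1 = B' 0 1 + B' 1 0 by rewrite B'10; ring.
  by rewrite b00 b01 b10 b11 G'10; ring.
have -> : B' 0 1 ^+ 2 = B' 0 1 * B' 1 0 by rewrite B'10.
by rewrite b00 b01 b10 b11 G'10; ring.
Qed.

(** Eigenvectors of B G^-1 for distinct eigenvalues are orthogonal for G; P has
the normalised eigenvectors as rows. *)
Lemma simultaneous_diagonalization B G a b : G \in unitmx ->
  B^T = B -> G^T = G -> (forall v : 'rV_2, v != 0 -> 0 < (v *m G *m v^T) 0 0) ->
  char_poly (B *m invmx G) = ('X - a%:P) * ('X - b%:P) -> a != b ->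
  exists2 P, P \in unitmx & P *m G *m P^T = 1%:M /\
   [/\ (P *m B *m P^T) 0 0 = a, (P *m B *m P^T) 0 1 = 0 & (P *m B *m P^T) 1 1 = b].
Proof.
move=> Gu Bs Gs Gpos charE ab.
have eig c : root (char_poly (B *m invmx G)) c ->
    exists v : 'rV_2, (v *m G *m v^T) 0 0 = 1 /\ v *m B = c *: (v *m G).
  rewrite -eigenvalue_root_char => /eigenvalueP[v vE v0].
  pose r := Num.sqrt ((v *m G *m v^T) 0 0).
  have r0 : r != 0 by rewrite sqrtr_eq0 -ltNge Gpos.
  exists (r^-1 *: v); split.
    rewrite -!scalemxAl linearZ /= -scalemxAr scalerA mxE.
    have q0 : 0 <= (v *m G *m v^T) 0 0 by rewrite ltW ?Gpos.
    by rewrite -(sqr_sqrtr q0) -/r; field.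
  rewrite -!scalemxAl scalerA mulrC -scalerA; congr (_ *: _).
  by rewrite -[v *m B]mulmx1 -(mulVmx Gu) mulmxA -[v *m B *m _]mulmxA vE -scalemxAl.
have [v [vv vB]] : exists v : 'rV_2, (v *m G *m v^T) 0 0 = 1 /\ v *m B = a *: (v *m G).
  by apply: eig; rewrite charE rootM root_XsubC eqxx.
have [w [ww wB]] : exists v : 'rV_2, (v *m G *m v^T) 0 0 = 1 /\ v *m B = b *: (v *m G).
  by apply: eig; rewrite charE rootM !root_XsubC eqxx orbT.
have symf (C : 'M[R]_2) : C^T = C -> (w *m C *m v^T) 0 0 = (v *m C *m w^T) 0 0.
  move=> Cs; have -> : w *m C *m v^T = (v *m C *m w^T)^T.
    by rewrite !trmx_mul trmxK Cs mulmxA.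
  by rewrite mxE.
have vw : (v *m G *m w^T) 0 0 = 0.
  have e1 : (v *m B *m w^T) 0 0 = a * (v *m G *m w^T) 0 0.
    by rewrite vB -scalemxAl mxE.
  have e2 : (w *m B *m v^T) 0 0 = b * (v *m G *m w^T) 0 0.
    by rewrite wB -scalemxAl mxE symf.
  have : (a - b) * (v *m G *m w^T) 0 0 = 0 by rewrite mulrBl -e1 -e2 symf ?subrr.
  by move/eqP; rewrite mulf_eq0 subr_eq0 (negbTE ab) => /eqP.
pose P : 'M[R]_2 := \matrix_(i < 2) (if i == 0 then v else w).
have r0 : row 0 P = v by rewrite rowK.
have r1 : row 1 P = w by rewrite rowK.
have entry (C : 'M[R]_2) i j : (P *m C *m P^T) i j = (row i P *m C *m (row j P)^T) 0 0.
  by rewrite -row_mul [LHS]mxE [RHS]mxE; apply: eq_bigr => k _; rewrite !mxE.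
have PG : P *m G *m P^T = 1%:M.
  apply/matrixP => i j; rewrite entry [RHS]mxE.
  have two (k : 'I_2) : k = 0 \/ k = 1.
    by case: k => -[|[|//]] k; [left | right]; apply: val_inj.
  case: (two i) => ->; case: (two j) => ->; rewrite ?r0 ?r1 ?(symf _ Gs) ?vv ?ww ?vw //.
have Pu : P \in unitmx.
  by have := PG; rewrite -mulmxA => /mulmx1_unit[].
refine (ex_intro2 _ _ P Pu _).
have sc c (C : 'M[R]_1) : (c *: C) 0 0 = c * C 0 0 by rewrite mxE.
split=> //; rewrite !entry r0 r1 vB wB -!scalemxAl !sc vv ww vw.
by rewrite !mulr1 mulr0.
Qed.

End TwoByTwo.

(** * Fundamental forms in space-time coordinates *)

Notation spacetime R := ('rV[R]_2 * R^o)%type.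

Section Coordinates.
Variables (R : realType) (V : normedModType R) (n : nat).
Implicit Types (U : set V) (f : V -> 'rV[R]_n).

Lemma derive_coord f x v c : derivable f x v ->
  ('D_v f x) 0 c = 'D_v (fun y => f y 0 c) x.
Proof. by move=> df; rewrite derive_mx // mxE. Qed.

Lemma coord_differentiable f x c :
  differentiable f x -> differentiable (fun y => f y 0 c) x.
Proof.
move=> df; apply: (@differentiable_comp _ _ _ _ f (fun M : 'rV[R]_n => M 0 c)) => //.
exact: differentiable_coord.
Qed.

Lemma Ck_coord k U f c : open U -> Ck k U f -> Ck k U (fun y => f y 0 c).
Proof.
move=> oU; elim: k f => [|k IH] f.
  move=> cf x Ux.
  apply: (@continuous_comp _ _ _ f (fun M : 'rV[R]_n => M 0 c) x (cf x Ux)).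
  exact: coord_continuous.
move=> [df cf]; split; first by move=> x Ux; apply: coord_differentiable; exact: df.
move=> v; have := IH _ (cf v); apply: Ck_eq => // x Ux.
by apply: derive_coord; apply: diff_derivable; exact: df.
Qed.

End Coordinates.

Section Slices.
Variables (R : realType) (W : normedModType R).

Lemma derive_slice (g : spacetime R -> W) (v u : 'rV[R]_2) (t : R^o) :
  'D_v (fun u' => g (u', t)) u = 'D_((v, 0) : spacetime R) g (u, t).
Proof.
suff E : (fun h : R => h^-1 *: (((fun u' => g (u', t)) \o shift u) (h *: v) - g (u, t)))
       = (fun h : R => h^-1 *: ((g \o shift (u, t)) (h *: ((v, 0) : spacetime R)) - g (u, t))).
  by rewrite /derive E.
apply/funext => h /=; congr (_ *: (g _ - _)).
by congr (_, _); rewrite /= scaler0 add0r.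
Qed.

Lemma near_slice (U : set (spacetime R)) u t : open U -> U (u, t) ->
  \forall u' \near u, U (u', t).
Proof.
move=> oU Uz; have : nbhs (u, t) U by apply: open_nbhs_nbhs; split.
move=> [[A B] /= [nA nB] AB].
apply: filterS nA => u' Au'; apply: AB; split => //=; exact: nbhs_singleton.
Qed.

Lemma derive_slice_eq (U : set (spacetime R)) (f : 'rV[R]_2 -> W)
    (g : spacetime R -> W) v u t : open U -> U (u, t) ->
  (forall u', U (u', t) -> f u' = g (u', t)) ->
  'D_v f u = 'D_((v, 0) : spacetime R) g (u, t).
Proof.
move=> oU Uz fg; rewrite -derive_slice; apply: near_eq_derive.
by apply: filterS (near_slice oU Uz) => u' /fg.
Qed.

End Slices.

Section FrameExpansion.
Variables (R : realType) (U : set (spacetime R)).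
Hypothesis oU : open U.
Implicit Types (phi : spacetime R -> R) (v w : 'rV[R]_2).

Definition space_dir (v : 'rV[R]_2) : spacetime R := (v, 0).
Local Notation e k := (space_dir (delta_mx 0 k)).

Lemma derive_lin (f : spacetime R -> R) z (a b : spacetime R) (p q : R) :
  differentiable f z -> 'D_(p *: a + q *: b) f z = p * 'D_a f z + q * 'D_b f z.
Proof.
by move=> df; rewrite !deriveE // linearP linearZ.
Qed.

Lemma space_dir_lin (v : 'rV[R]_2) :
  space_dir v = v 0 0 *: e 0 + v 0 1 *: e 1.
Proof.
rewrite /space_dir; congr (_, _); last by rewrite /= !scaler0 addr0.
rewrite [LHS]row_sum_delta big_ord_recl big_ord_recl big_ord0 addr0.
by congr (_ + v 0 _ *: delta_mx 0 _); apply: val_inj.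
Qed.

Lemma derive_space_dir phi v z : smooth U phi -> U z ->
  'D_(space_dir v) phi z = v 0 0 * 'D_(e 0) phi z + v 0 1 * 'D_(e 1) phi z.
Proof.
move=> sphi Uz; rewrite space_dir_lin derive_lin //.
by have [d _] := sphi 1; exact: d.
Qed.

(** The directions are constant, so that second derivatives along them are
bilinear in the coordinates. *)
Lemma derive2_space_dir phi v w z : smooth U phi -> U z ->
  'D_(space_dir v) ('D_(space_dir w) phi) z =
   v 0 0 * (w 0 0 * 'D_(e 0) ('D_(e 0) phi) z + w 0 1 * 'D_(e 0) ('D_(e 1) phi) z)
 + v 0 1 * (w 0 0 * 'D_(e 1) ('D_(e 0) phi) z + w 0 1 * 'D_(e 1) ('D_(e 1) phi) z).
Proof.
move=> sphi Uz; have sw := smooth_deriv (space_dir w) sphi.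
apply: (etrans (derive_space_dir v sw Uz)).
have E k : 'D_(e k) ('D_(space_dir w) phi) z =
    w 0 0 * 'D_(e k) ('D_(e 0) phi) z + w 0 1 * 'D_(e k) ('D_(e 1) phi) z.
  transitivity ('D_(e k) ((w 0 0 \*: 'D_(e 0) phi) + (w 0 1 \*: 'D_(e 1) phi)) z).
    apply: near_eq_derive.
    apply: filterS (open_nbhs_nbhs (conj oU Uz)) => y Uy.
    exact: (derive_space_dir w sphi Uy).
  have d j : derivable ('D_(e j) phi) z (e k).
    by apply: diff_derivable; have [d _] := smooth_deriv (e j) sphi 1; exact: d.
  have D := deriveD (@derivableZ _ _ _ _ (w 0 0) _ _ (d 0))
    (@derivableZ _ _ _ _ (w 0 1) _ _ (d 1)).
  apply: (etrans D).
  by congr (_ + _); [exact: (deriveZ (w 0 0) (d 0)) | exact: (deriveZ (w 0 1) (d 1))].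
by congr (_ * _ + _ * _); exact: E.
Qed.
End FrameExpansion.

Section Forms.
Variables (R : realType).
Implicit Types (n : 'rV[R]_3) (P : 'M[R]_2).
Local Notation e k := (space_dir (delta_mx 0 k)).

Definition coords (m : 'rV[R]_3) : 'I_3 -> R := fun c => m 0 c.

Lemma dotE (v w : 'rV[R]_3) : dot v w = ip (coords v) (coords w).
Proof.
rewrite /dot mxE !big_ord_recl big_ord0 addr0 /ip /coords addrA.
by congr (_ + _ + _); rewrite mxE; congr (v 0 _ * w 0 _); apply: val_inj.
Qed.

Lemma first_form_frame (f : 'rV[R]_2 -> 'rV[R]_3) u :
  first_form f u = frame f u *m (frame f u)^T.
Proof.
apply/matrixP => j k; rewrite !mxE /dot mxE; apply: eq_bigr => c _.
by rewrite !mxE.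
Qed.

Lemma first_form_sym (f : 'rV[R]_2 -> 'rV[R]_3) u :
  (first_form f u)^T = first_form f u.
Proof. by rewrite first_form_frame trmx_mul trmxK. Qed.

Lemma first_form_posdef (f : 'rV[R]_2 -> 'rV[R]_3) u :
  row_free (frame f u) ->
  forall v : 'rV_2, v != 0 -> 0 < (v *m first_form f u *m v^T) 0 0.
Proof.
move=> ff v v0; rewrite first_form_frame mulmxA -mulmxA -trmx_mul.
set w := v *m _; have w0 : w != 0.
  by apply: contra_neq v0 => w0; apply: (row_free_inj ff); rewrite mul0mx.
rewrite mxE lt_neqAle sumr_ge0 ?andbT => [|c _]; last first.
  by rewrite [w^T c 0]mxE -expr2 sqr_ge0.
apply: contra_neq w0 => /esym/eqP; rewrite psumr_eq0 => [|c _]; last first.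
  by rewrite [w^T c 0]mxE -expr2 sqr_ge0.
move=> /allP h; apply/rowP => c; have := h c (mem_index_enum c).
by rewrite [w^T c 0]mxE /= mulf_eq0 orbb [RHS]mxE => /eqP.
Qed.

Lemma first_form_unit (f : 'rV[R]_2 -> 'rV[R]_3) u :
  row_free (frame f u) -> first_form f u \in unitmx.
Proof.
move=> ff; rewrite -row_free_unit; apply: inj_row_free => v vG.
apply/eqP/negPn/negP => /(first_form_posdef ff).
by rewrite vG mul0mx mxE ltxx.
Qed.

Lemma second_formE (f : 'rV[R]_2 -> 'rV[R]_3) u n j k :
  second_form f u n j k = - dot (partial j (partial k f) u) n.
Proof. by rewrite mxE. Qed.

Lemma eq_ip2 (x x' y y' : 'I_3 -> R) : x =1 x' -> y =1 y' -> ip x y = ip x' y'.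
Proof. by move=> E E'; rewrite /ip !E !E'. Qed.

Lemma ip_comb (a0 a1 b0 b1 : R) (x0 x1 y0 y1 : 'I_3 -> R) :
  ip (fun c => a0 * x0 c + a1 * x1 c) (fun c => b0 * y0 c + b1 * y1 c)
  = a0 * (b0 * ip x0 y0 + b1 * ip x0 y1) + a1 * (b0 * ip x1 y0 + b1 * ip x1 y1).
Proof. by rewrite /ip; ring. Qed.

Lemma ip_combr (a0 a1 : R) (v x0 x1 : 'I_3 -> R) :
  ip v (fun c => a0 * x0 c + a1 * x1 c) = a0 * ip v x0 + a1 * ip v x1.
Proof. by rewrite /ip; ring. Qed.

Lemma ip_comb2 (a0 a1 b0 b1 : R) (x00 x01 x10 x11 y : 'I_3 -> R) :
  - ip (fun c => a0 * (b0 * x00 c + b1 * x01 c) + a1 * (b0 * x10 c + b1 * x11 c)) y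
  = a0 * (b0 * - ip x00 y + b1 * - ip x01 y)
  + a1 * (b0 * - ip x10 y + b1 * - ip x11 y).
Proof. by rewrite /ip; ring. Qed.

Lemma mx_conj2 (P B : 'M[R]_2) i j : (P *m B *m P^T) i j =
  P i 0 * (P j 0 * B 0 0 + P j 1 * B 0 1)
  + P i 1 * (P j 0 * B 1 0 + P j 1 * B 1 1).
Proof. by rewrite !mxE sum_ord2 !mxE !sum_ord2; ring. Qed.

Section Link.
Variables (U : set (spacetime R)) (g : spacetime R -> 'rV[R]_3).
Hypotheses (oU : open U) (sg : smooth U g).
Variables (u : 'rV[R]_2) (t : R) (f : 'rV[R]_2 -> 'rV[R]_3).
Hypotheses (Uz : U (u, t)) (fg : forall u', U (u', t) -> f u' = g (u', t)).

Definition coord_fun c : spacetime R -> R := fun z => g z 0 c.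

Lemma coord_fun_smooth c : smooth U (coord_fun c).
Proof. by move=> k; exact: Ck_coord. Qed.

Lemma g_derivable y v : U y -> derivable g y v.
Proof. by move=> Uy; apply: diff_derivable; have [d _] := sg 1; exact: d. Qed.

Lemma partial_coord j u' c : U (u', t) ->
  partial j f u' 0 c = 'D_(e j) (coord_fun c) (u', t).
Proof.
move=> Uz'; rewrite /partial (derive_slice_eq (delta_mx 0 j) oU Uz' fg).
exact: (derive_coord c (g_derivable Uz')). 
Qed.

Lemma partial2_coord j k c :
  partial j (partial k f) u 0 c = 'D_(e j) ('D_(e k) (coord_fun c)) (u, t).
Proof.
have E u' : U (u', t) -> partial k f u' = 'D_(e k) g (u', t).
  by move=> Uz'; rewrite /partial (derive_slice_eq (delta_mx 0 k) oU Uz' fg).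
have -> : partial j (partial k f) u = 'D_(e j) ('D_(e k) g) (u, t).
  exact: (derive_slice_eq (delta_mx 0 j) oU Uz E).
have d : derivable ('D_(e k) g) (u, t) (e j).
  by apply: diff_derivable; have [_ /(_ (e k))[d _]] := sg 2; exact: d.
apply: (etrans (derive_coord c d)); apply: near_eq_derive.
apply: filterS (open_nbhs_nbhs (conj oU Uz)) => y Uy.
exact: (derive_coord c (g_derivable Uy)).
Qed.

Lemma second_form_sym n : (second_form f u n)^T = second_form f u n.
Proof.
have C j k : partial j (partial k f) u = partial k (partial j f) u.
  apply/rowP => c.
  have E := derive_comm (e k) (e j) oU Uz (coord_fun_smooth c 2).
  exact: etrans (partial2_coord j k c) (etrans E (esym (partial2_coord k j c))).
apply/matrixP => j k.
by rewrite [LHS]mxE !second_formE C.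
Qed.

Definition dir P (i : 'I_2) : spacetime R := space_dir (row i P).

Lemma first_form_dir P i j :
  ip (fun c => 'D_(dir P i) (coord_fun c) (u, t)) (fun c => 'D_(dir P j) (coord_fun c) (u, t))
  = (P *m first_form f u *m P^T) i j.
Proof.
have E k c : 'D_(dir P k) (coord_fun c) (u, t) =
    P k 0 * coords (partial 0 f u) c + P k 1 * coords (partial 1 f u) c.
  apply: (etrans (derive_space_dir (row k P) (coord_fun_smooth c) Uz)).
  congr (_ * _ + _ * _); rewrite ?mxE //; exact/esym/partial_coord.
have F a b : first_form f u a b =
    ip (coords (partial a f u)) (coords (partial b f u)) by rewrite mxE dotE.
rewrite mx_conj2 !F -ip_comb; apply: eq_ip2 => c; exact: E.
Qed.

Lemma second_form_dir P n i j :
  - ip (fun c => 'D_(dir P i) ('D_(dir P j) (coord_fun c)) (u, t)) (coords n)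
  = (P *m second_form f u n *m P^T) i j.
Proof.
have E c : 'D_(dir P i) ('D_(dir P j) (coord_fun c)) (u, t) =
    P i 0 * (P j 0 * coords (partial 0 (partial 0 f) u) c
           + P j 1 * coords (partial 0 (partial 1 f) u) c)
  + P i 1 * (P j 0 * coords (partial 1 (partial 0 f) u) c
           + P j 1 * coords (partial 1 (partial 1 f) u) c).
  apply: (etrans (derive2_space_dir oU (row i P) (row j P) (coord_fun_smooth c) Uz)).
  congr (_ * (_ * _ + _ * _) + _ * (_ * _ + _ * _)); rewrite ?mxE //;
    exact/esym/partial2_coord.
have F a b : second_form f u n a b =
    - ip (coords (partial a (partial b f) u)) (coords n) by rewrite second_formE dotE.
rewrite mx_conj2 !F -ip_comb2; congr (- _).
by apply: eq_ip2 => c //; exact: E.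
Qed.

End Link.
End Forms.

(** * Unit normals and the orientation of convex surfaces *)

Section CrossProduct.
Variable A : comNzRingType.
Implicit Types (x y : 'I_3 -> A).

Definition cross x y : 'I_3 -> A := fun c =>
  if c == 0 then x 1 * y 2 - x 2 * y 1
  else if c == 1 then x 2 * y 0 - x 0 * y 2 else x 0 * y 1 - x 1 * y 0.

Definition gram x y : A := ip x x * ip y y - ip x y ^+ 2.

Lemma cross_ipl x y : ip (cross x y) x = 0.
Proof. by rewrite /ip /cross /=; ring. Qed.
Lemma cross_ipr x y : ip (cross x y) y = 0.
Proof. by rewrite /ip /cross /=; ring. Qed.
(** The identity of Lagrange. *)
Lemma cross_norm x y : ip (cross x y) (cross x y) = gram x y.
Proof. by rewrite /gram /ip /cross /=; ring. Qed.
End CrossProduct.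

Section UnitNormal.
Variable R : rcfType.
Implicit Types (x y n : 'I_3 -> R) (s : R).

(** For s = 1 or s = - 1, one of the two unit normals. *)
Definition unit_cross s x y : 'I_3 -> R :=
  fun c => s * cross x y c * (Num.sqrt (gram x y))^-1.

Lemma ip_unit_cross s x y v :
  ip (unit_cross s x y) v = s * (Num.sqrt (gram x y))^-1 * ip (cross x y) v.
Proof. by rewrite /ip /unit_cross; ring. Qed.

Lemma unit_cross_frame s x y : s ^+ 2 = 1 -> 0 < gram x y ->
  moving_frame x y (unit_cross s x y) (gram x y)^-1.
Proof.
move=> s2 g0; split.
- rewrite ip_unit_cross ipC ip_unit_cross cross_norm.
  rewrite -{3}(sqr_sqrtr (ltW g0)).
  have r0 : Num.sqrt (gram x y) != 0 by rewrite sqrtr_eq0 -ltNge.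
  by rewrite -s2; field.
- by rewrite ip_unit_cross cross_ipl mulr0.
- by rewrite ip_unit_cross cross_ipr mulr0.
- by rewrite -/(gram x y) mulVf // gt_eqF.
Qed.

Lemma unit_normal_cross x y n : 0 < gram x y ->
  ip n n = 1 -> ip n x = 0 -> ip n y = 0 ->
  exists2 s, s ^+ 2 = 1 & n =1 unit_cross s x y.
Proof.
move=> g0 nn nx ny.
have fr := unit_cross_frame (expr1n _ 2) g0.
pose s := ip n (unit_cross 1 x y).
have nE c : n c = s * unit_cross 1 x y c.
  by rewrite [LHS](frame_decomp fr) nx ny /s; ring.
have [uu _ _ _] := fr.
exists s.
  rewrite -nn -[LHS]mulr1 -uu /ip !nE; ring.
by move=> c; rewrite nE /unit_cross mul1r mulrA.
Qed.

(** Replacing the unit normal by the cross product of the tangent vectors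
removes the square root: the numerator of the Gauss curvature is
rescaled by the Gram determinant, and the one of the mean curvature keeps the
sign of the orientation. *)
Lemma curvature_unit_cross s x y (d11 d12 d22 : 'I_3 -> R) n a b :
  0 < gram x y -> s ^+ 2 = 1 -> n =1 unit_cross s x y ->
  let k d := - ip d (cross x y) in let h d := - ip d n in
  (a + b) * gram x y
    = h d11 * ip y y - 2 * h d12 * ip x y + h d22 * ip x x ->
  a * b * gram x y = h d11 * h d22 - h d12 ^+ 2 ->
  k d11 * ip y y - 2 * k d12 * ip x y + k d22 * ip x x
    = s * ((a + b) * gram x y * Num.sqrt (gram x y)) /\
  k d11 * k d22 - k d12 ^+ 2 = a * b * gram x y ^+ 2.
Proof.
move=> g0 s2 nE k h E1 E2.
set r := Num.sqrt (gram x y).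
have r0 : r != 0 by rewrite sqrtr_eq0 -ltNge.
have rr : r ^+ 2 = gram x y by rewrite sqr_sqrtr // ltW.
have kh d : k d = s * r * h d.
  rewrite /k /h /ip !nE /unit_cross -/r.
  transitivity (s ^+ 2 * - (d 0 * cross x y 0 + d 1 * cross x y 1 + d 2 * cross x y 2)).
    by rewrite s2 mul1r.
  by field.
rewrite !kh; split; first by rewrite E1; ring.
transitivity (s ^+ 2 * r ^+ 2 * (h d11 * h d22 - h d12 ^+ 2)); first by ring.
by rewrite -E2 s2 rr; ring.
Qed.

End UnitNormal.

Section SmfunEval.
Variables (R : realType) (V : normedModType R) (D : pointed_open V).
Implicit Types (f g : smfun D).
Local Notation U := (po_set D).

Lemma smfun_ip (x y : 'I_3 -> smfun D) z : U z ->
  ip x y z = ip (fun c => x c z) (fun c => y c z).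
Proof. by move=> Uz; rewrite /ip !smfunD // !smfunM. Qed.

Lemma gram_form_eval (G g11 g12 g22 : smfun D) z : U z ->
  (G * (g11 * g22 - g12 ^+ 2)) z = G z * (g11 z * g22 z - g12 z ^+ 2).
Proof. by move=> Uz; rewrite [_ ^+ 2]expr2 !(smfunD, smfunM, smfunN). Qed.

Lemma mean_form_eval (G h11 h12 h22 g11 g12 g22 : smfun D) z : U z ->
  (G * (h11 * g22 - h12 * g12) + G * (h22 * g11 - h12 * g12)) z =
  G z * (h11 z * g22 z - 2 * h12 z * g12 z + h22 z * g11 z).
Proof. by move=> Uz; rewrite !(smfunD, smfunM, smfunN) //; ring. Qed.

Lemma gauss_form_eval (G h11 h12 h22 g11 g12 g22 : smfun D) z : U z ->
  G * (g11 * g22 - g12 ^+ 2) = 1 ->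
  (G * (h11 * g22 - h12 * g12) * (G * (h22 * g11 - h12 * g12))
   - G * (h12 * g11 - h11 * g12) * (G * (h12 * g22 - h22 * g12))) z =
  G z * (h11 z * h22 z - h12 z ^+ 2).
Proof.
move=> Uz gr.
have -> : G * (h11 * g22 - h12 * g12) * (G * (h22 * g11 - h12 * g12))
   - G * (h12 * g11 - h11 * g12) * (G * (h12 * g22 - h22 * g12))
   = G * (g11 * g22 - g12 ^+ 2) * (G * (h11 * h22 - h12 * h12)) by ring.
by rewrite gr mul1r !(smfunD, smfunM, smfunN).
Qed.

End SmfunEval.

Section LocalSurface.
Variables (R : realType) (g : spacetime R -> 'rV[R]_3) (P : 'M[R]_2).

Definition dX (j : 'I_2) z : 'I_3 -> R := fun c => 'D_(dir P j) (coord_fun g c) z.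
Definition ddX (j k : 'I_2) z : 'I_3 -> R :=
  fun c => 'D_(dir P j) ('D_(dir P k) (coord_fun g c)) z.

Definition gramX z := gram (dX 0 z) (dX 1 z).
Definition normal_coef (n : 'I_3 -> R) j k z := - ip (ddX j k z) n.
Definition crossX z := cross (dX 0 z) (dX 1 z).

(** Numerators of the mean and of the Gauss curvature; the common denominator
is the Gram determinant. *)
Definition mean_num (n : 'I_3 -> R) z : R :=
  normal_coef n 0 0 z * ip (dX 1 z) (dX 1 z)
  - 2 * normal_coef n 0 1 z * ip (dX 0 z) (dX 1 z)
  + normal_coef n 1 1 z * ip (dX 0 z) (dX 0 z).
Definition gauss_num (n : 'I_3 -> R) z : R :=
  normal_coef n 0 0 z * normal_coef n 1 1 z - normal_coef n 0 1 z ^+ 2.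

Variables (U : set (spacetime R)).
Hypotheses (oU : open U) (sg : smooth U g) (Pu : P \in unitmx).
Variables (u : 'rV[R]_2) (t : R) (f : 'rV[R]_2 -> 'rV[R]_3).
Hypotheses (Uz : U (u, t)) (fg : forall u', U (u', t) -> f u' = g (u', t)).
Hypothesis f_free : row_free (frame f u).

Let z : spacetime R := (u, t).

Lemma ip_dX j k : ip (dX j z) (dX k z) = (P *m first_form f u *m P^T) j k.
Proof. exact: (first_form_dir oU sg Uz fg). Qed.

Lemma normal_coefE n j k :
  normal_coef (coords n) j k z = (P *m second_form f u n *m P^T) j k.
Proof. exact: (second_form_dir oU sg Uz fg). Qed.

Lemma gramX_gt0 : 0 < gramX z.
Proof.
have ge0 : 0 <= gramX z.
  by rewrite /gramX -cross_norm /ip -!expr2 !addr_ge0 // sqr_ge0.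
rewrite lt_neqAle ge0 andbT eq_sym /gramX /gram.
set G' := P *m first_form f u *m P^T.
have G'u : G' \in unitmx.
  by rewrite !unitmx_mul unitmx_tr Pu first_form_unit.
have G'10 : G' 1 0 = G' 0 1.
  by apply: mxsym2; rewrite /G' !trmx_mul trmxK first_form_sym mulmxA.
have -> : ip (dX 0 z) (dX 0 z) * ip (dX 1 z) (dX 1 z) - ip (dX 0 z) (dX 1 z) ^+ 2
    = G' 0 0 * G' 1 1 - G' 0 1 ^+ 2 by congr (_ * _ - _ ^+ 2); exact: ip_dX.
move: G'u G'10; rewrite unitmxE unitfE det2; move: G' => G' + G'10.
by rewrite G'10 expr2.
Qed.

Lemma curvature_num n a b :
  char_poly (second_form f u n *m invmx (first_form f u))
    = ('X - a%:P) * ('X - b%:P) ->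
  (a + b) * gramX z = mean_num (coords n) z /\
  a * b * gramX z = gauss_num (coords n) z.
Proof.
move=> E; have [E1 E2] := curvature_frame_change Pu (first_form_unit f_free)
  (second_form_sym oU sg Uz fg n) (first_form_sym f u) E.
rewrite -(ip_dX 0 0) in E1 E2.
rewrite -(ip_dX 0 1) in E1 E2.
rewrite -(ip_dX 1 1) in E1 E2.
rewrite -(normal_coefE n 0 0) in E1 E2.
rewrite -(normal_coefE n 0 1) in E1 E2.
rewrite -(normal_coefE n 1 1) in E1 E2.
split.
  exact: E1.
exact: E2.
Qed.

(** One of the two orientations makes the mean curvature positive, and the
prescribed normal is the unit normal for this orientation.  The sign of the
numerator [mean_num], computed with the cross product, tells which one it is. *)
Lemma local_orientation n a b : 0 < a -> 0 < b ->
  char_poly (second_form f u n *m invmx (first_form f u))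
    = ('X - a%:P) * ('X - b%:P) ->
  dot n n = 1 -> (forall j, dot n (partial j f u) = 0) ->
  exists s, [/\ s ^+ 2 = 1, coords n =1 unit_cross s (dX 0 z) (dX 1 z),
     0 < s * mean_num (crossX z) z & 0 < gauss_num (crossX z) z].
Proof.
move=> a0 b0 E nn nf.
have [E1 E2] := curvature_num E.
have nd j : ip (coords n) (dX j z) = 0.
  have Ej c : dX j z c =
      P j 0 * coords (partial 0 f u) c + P j 1 * coords (partial 1 f u) c.
    rewrite /dX; apply: (etrans (derive_space_dir (row j P) (coord_fun_smooth oU sg c) Uz)).
    congr (_ * _ + _ * _); rewrite ?mxE //; exact/esym/(partial_coord oU sg).
  apply: (etrans (eq_ip2 (fun=> erefl) Ej)).
  have nf' k : ip (coords n) (coords (partial k f u)) = 0.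
    exact: etrans (esym (dotE _ _)) (nf k).
  apply: (etrans (ip_combr _ _ _ _ _)).
  apply: (etrans (congr2 (fun p q => P j 0 * p + P j 1 * q) (nf' 0) (nf' 1))).
  by rewrite !mulr0 addr0.
have g0 := gramX_gt0.
have nn' : ip (coords n) (coords n) = 1 by rewrite -dotE.
have [s s2 nE] := unit_normal_cross g0 nn' (nd 0) (nd 1).
have [E3 E4] := curvature_unit_cross g0 s2 nE E1 E2.
have E3' : mean_num (crossX z) z = s * ((a + b) * gramX z * Num.sqrt (gramX z)).
  exact: E3.
have E4' : gauss_num (crossX z) z = a * b * gramX z ^+ 2 by exact: E4.
exists s; rewrite E3' E4'; split=> //.
  rewrite mulrA -expr2 s2 mul1r; apply: mulr_gt0; last by rewrite sqrtr_gt0.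
  by apply: mulr_gt0 => //; exact: addr_gt0.
by apply: mulr_gt0; [exact: mulr_gt0 | exact: exprn_gt0].
Qed.

End LocalSurface.

(** * The differential ring of a surface depending on time *)

Section SmoothVectors.
Variables (R : realType) (V : normedModType R) (U : set V).
Hypothesis oU : open U.

Lemma smooth_ip (x y : V -> 'I_3 -> R) :
  (forall c, smooth U (fun z => x z c)) -> (forall c, smooth U (fun z => y z c)) ->
  smooth U (fun z => ip (x z) (y z)).
Proof.
by move=> sx sy; do 2?apply: smoothD => //; apply: smoothM.
Qed.
Lemma smooth_cross (x y : V -> 'I_3 -> R) c :
  (forall c, smooth U (fun z => x z c)) -> (forall c, smooth U (fun z => y z c)) ->
  smooth U (fun z => cross (x z) (y z) c).
Proof.
move=> sx sy; rewrite /cross.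
by case: (c == 0); [|case: (c == 1)]; apply: smoothB => //; apply: smoothM.
Qed.

End SmoothVectors.

Section LocalSmooth.
Variables (R : realType) (g : spacetime R -> 'rV[R]_3) (P : 'M[R]_2).
Variables (U : set (spacetime R)).
Hypotheses (oU : open U) (sg : smooth U g).

Lemma smooth_dX j c : smooth U (fun z => dX g P j z c).
Proof. exact: (smooth_deriv _ (coord_fun_smooth oU sg c)). Qed.
Lemma smooth_ddX j k c : smooth U (fun z => ddX g P j k z c).
Proof. exact: (smooth_deriv _ (smooth_deriv _ (coord_fun_smooth oU sg c))). Qed.
Lemma smooth_gramX : smooth U (gramX g P).
Proof.
have s j k : smooth U (fun z => ip (dX g P j z) (dX g P k z)).
  by apply: smooth_ip => // c; exact: smooth_dX.
exact: (smoothB oU (smoothM oU (s 0 0) (s 1 1)) (smoothX2 oU (s 0 1))).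
Qed.
Lemma smooth_crossX c : smooth U (fun z => crossX g P z c).
Proof. by apply: smooth_cross => // c'; exact: smooth_dX. Qed.
Lemma smooth_normal_coef j k : smooth U (fun z => normal_coef g P (crossX g P z) j k z).
Proof.
apply: smoothN => //; apply: smooth_ip => // c.
  exact: smooth_ddX.
exact: smooth_crossX.
Qed.
Lemma smooth_mean_num : smooth U (fun z => mean_num g P (crossX g P z) z).
Proof.
have s j k : smooth U (fun z => ip (dX g P j z) (dX g P k z)).
  by apply: smooth_ip => // c; exact: smooth_dX.
have n := smooth_normal_coef.
apply: (smoothD oU (smoothB oU (smoothM oU (n 0 0) (s 1 1)) _) (smoothM oU (n 1 1) (s 0 0))).
exact: (smoothM oU (smoothM oU (smoothC U 2) (n 0 1)) (s 0 1)).
Qed.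
Lemma smooth_gauss_num : smooth U (fun z => gauss_num g P (crossX g P z) z).
Proof.
have n := smooth_normal_coef.
exact: (smoothB oU (smoothM oU (n 0 0) (n 1 1)) (smoothX2 oU (n 0 1))).
Qed.

End LocalSmooth.

Lemma rescale_det (R : realFieldType) (s r m k11 k12 k22 : R) :
  r != 0 -> r ^+ 2 = m -> s ^+ 2 = 1 ->
  s * r^-1 * k11 * (s * r^-1 * k22) - (s * r^-1 * k12) ^+ 2
  = m^-1 * (k11 * k22 - k12 ^+ 2).
Proof.
move=> r0 <- s2; transitivity (s ^+ 2 * ((r ^+ 2)^-1 * (k11 * k22 - k12 ^+ 2))).
  by field.
by rewrite s2 mul1r.
Qed.

Section LocalRing.
Variables (R : realType) (g : spacetime R -> 'rV[R]_3) (P : 'M[R]_2).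
Variables (D : pointed_open (spacetime R)) (sigma : R).
Local Notation U := (po_set D).
Hypotheses (sg : smooth U g) (sigma2 : sigma ^+ 2 = 1).
Hypothesis gram_gt0 : forall z, U z -> 0 < gramX g P z.
Hypothesis gauss_gt0 : forall z, U z -> 0 < gauss_num g P (crossX g P z) z.

Let oU : open U := po_open D.

Definition oriented_normal z : 'I_3 -> R := unit_cross sigma (dX g P 0 z) (dX g P 1 z).

Lemma gram_neq0 z : U z -> gramX g P z != 0.
Proof. by move=> Uz; rewrite gt_eqF ?gram_gt0. Qed.

Lemma smooth_loc_n c : smooth U (fun z => oriented_normal z c).
Proof.
have r : smooth U (fun z => (Num.sqrt (gramX g P z))^-1).
  have s0 z : U z -> Num.sqrt (gramX g P z) != 0.
    by move=> Uz; rewrite sqrtr_eq0 -ltNge gram_gt0.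
  exact: (smoothV oU s0 (smooth_sqrt oU gram_gt0 (smooth_gramX P oU sg))).
exact: (smoothM oU (smoothM oU (smoothC U sigma) (smooth_crossX P oU sg c)) r).
Qed.

Lemma smooth_loc_G : smooth U (fun z => (gramX g P z)^-1).
Proof. exact: (smoothV oU gram_neq0 (smooth_gramX P oU sg)). Qed.

Lemma smooth_loc_J :
  smooth U (fun z => gramX g P z ^+ 2 * (gauss_num g P (crossX g P z) z)^-1).
Proof.
have k0 z : U z -> gauss_num g P (crossX g P z) z != 0.
  by move=> Uz; rewrite gt_eqF ?gauss_gt0.
have s := smoothV oU k0 (smooth_gauss_num P oU sg).
exact: (smoothM oU (smoothX2 oU (smooth_gramX P oU sg)) s).
Qed.

(** Position, unit normal, inverse of the Gram determinant and inverse of the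
Gauss curvature, as elements of the ring of smooth functions on D. *)
Definition loc_X c : smfun D := mk_smfun (coord_fun_smooth oU sg c).
Definition loc_n c : smfun D := mk_smfun (smooth_loc_n c).
Definition loc_G : smfun D := mk_smfun smooth_loc_G.
Definition loc_J : smfun D := mk_smfun smooth_loc_J.
Definition loc_d (j : 'I_2) : derivation (smfun D) := sderivation D (dir P j).

Lemma loc_XE c z : U z -> loc_X c z = coord_fun g c z.
Proof. exact: mk_smfunE. Qed.
Lemma loc_nE c z : U z -> loc_n c z = oriented_normal z c.
Proof. exact: mk_smfunE. Qed.
Lemma loc_GE z : U z -> loc_G z = (gramX g P z)^-1.
Proof. exact: mk_smfunE. Qed.
Lemma loc_JE z : U z -> loc_J z = gramX g P z ^+ 2 / gauss_num g P (crossX g P z) z.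
Proof. exact: mk_smfunE. Qed.

Lemma der_loc_X v c z : U z -> sderivation D v (loc_X c) z = 'D_v (coord_fun g c) z.
Proof.
move=> Uz; apply: (etrans (sderivationE v _ Uz)).
by apply: derive_in Uz _ => y; exact: loc_XE.
Qed.

Lemma loc_d_X j c z : U z -> vder (loc_d j) loc_X c z = dX g P j z c.
Proof. exact: der_loc_X. Qed.

Lemma loc_dd_X j k c z : U z -> vder (loc_d j) (vder (loc_d k) loc_X) c z = ddX g P j k z c.
Proof.
move=> Uz; apply: (etrans (sderivationE _ _ Uz)).
by apply: derive_in Uz _ => y; exact: loc_d_X.
Qed.

Lemma first_coefE j k z : U z ->
  first_coef loc_X (loc_d j) (loc_d k) z = ip (dX g P j z) (dX g P k z).
Proof.
move=> Uz; apply: (etrans (smfun_ip _ _ Uz)).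
by apply: eq_ip2 => c; exact: loc_d_X.
Qed.

Lemma second_coefE j k z : U z ->
  second_coef loc_X loc_n (loc_d j) (loc_d k) z = normal_coef g P (oriented_normal z) j k z.
Proof.
move=> Uz; apply: (etrans (smfunN _ Uz)); congr (- _).
apply: (etrans (smfun_ip _ _ Uz)).
by apply: eq_ip2 => c; [exact: loc_dd_X | exact: loc_nE].
Qed.

Lemma local_frame : moving_frame (vder (loc_d 0) loc_X) (vder (loc_d 1) loc_X) loc_n loc_G.
Proof.
have fr z : U z -> _ := fun Uz => unit_cross_frame sigma2 (gram_gt0 Uz).
split; apply: smfunP => z Uz; have [nn nx ny gr] := fr z Uz.
- rewrite (smfun_ip _ _ Uz) (smfun1 Uz) -[RHS]nn.
  by apply: eq_ip2 => c; exact: loc_nE.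
- rewrite (smfun_ip _ _ Uz) (smfun0 Uz) -[RHS]nx.
  by apply: eq_ip2 => c; [exact: loc_nE | exact: loc_d_X].
- rewrite (smfun_ip _ _ Uz) (smfun0 Uz) -[RHS]ny.
  by apply: eq_ip2 => c; [exact: loc_nE | exact: loc_d_X].
rewrite (smfun1 Uz) -[RHS]gr; apply: (etrans (gram_form_eval _ _ _ _ Uz)).
congr (_ * (_ * _ - _ ^+ 2)).
- exact: loc_GE.
- exact: (first_coefE 0 0 Uz).
- exact: (first_coefE 1 1 Uz).
- exact: (first_coefE 0 1 Uz).
Qed.

Local Notation mean := (mean_curv (loc_d 0) (loc_d 1) loc_X loc_n loc_G).
Local Notation gauss := (gauss_curv (loc_d 0) (loc_d 1) loc_X loc_n loc_G).

Lemma local_mean z : U z -> mean z = (gramX g P z)^-1 * mean_num g P (oriented_normal z) z.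
Proof.
move=> Uz; apply: (etrans (mean_form_eval _ _ _ _ _ _ _ Uz)).
congr (_ * (_ * _ - 2 * _ * _ + _ * _)).
- exact: loc_GE.
- exact: (second_coefE 0 0 Uz).
- exact: (first_coefE 1 1 Uz).
- exact: (second_coefE 0 1 Uz).
- exact: (first_coefE 0 1 Uz).
- exact: (second_coefE 1 1 Uz).
- exact: (first_coefE 0 0 Uz).
Qed.

Lemma local_gauss z : U z -> gauss z = (gramX g P z)^-1 * gauss_num g P (oriented_normal z) z.
Proof.
move=> Uz; have [_ _ _ gr] := local_frame.
apply: (etrans (gauss_form_eval _ _ _ Uz gr)).
congr (_ * (_ * _ - _ ^+ 2)).
- exact: loc_GE.
- exact: (second_coefE 0 0 Uz).
- exact: (second_coefE 1 1 Uz).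
- exact: (second_coefE 0 1 Uz).
Qed.

Lemma local_gauss_inv : gauss * loc_J = 1.
Proof.
apply: smfunP => z Uz; apply: (etrans (smfunM _ _ Uz)).
apply: etrans (esym (smfun1 Uz)).
have -> : gauss z = (gramX g P z)^-1 * gauss_num g P (oriented_normal z) z.
  exact: local_gauss.
have -> : loc_J z = gramX g P z ^+ 2 / gauss_num g P (crossX g P z) z by exact: loc_JE.
have g0 := gram_gt0 Uz; have K0 := gauss_gt0 Uz.
have kE j k : normal_coef g P (oriented_normal z) j k z =
    sigma * (Num.sqrt (gramX g P z))^-1 * normal_coef g P (crossX g P z) j k z.
  by rewrite /normal_coef ipC ip_unit_cross (ipC (cross _ _)) mulrN.
have -> : gauss_num g P (oriented_normal z) z = (gramX g P z)^-1 * gauss_num g P (crossX g P z) z.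
  have r0 : Num.sqrt (gramX g P z) != 0 by rewrite sqrtr_eq0 -ltNge.
  rewrite {1}/gauss_num !kE.
  exact: (rescale_det _ _ _ r0 (sqr_sqrtr (ltW g0)) sigma2).
move: g0 K0; move: (gramX g P z) (gauss_num _ _ _ z) => m k m0 k0.
by field; rewrite !gt_eqF.
Qed.

End LocalRing.

Lemma open_gt0 (R : realType) (V : normedModType R) (U : set V) (f : V -> R) :
  open U -> smooth U f -> open [set z | U z /\ 0 < f z].
Proof.
move=> oU sf; rewrite openE => z [Uz fz].
have c : {for z, continuous f} := smooth_cont sf Uz.
have n1 : nbhs z U := open_nbhs_nbhs (conj oU Uz).
have n2 : nbhs z [set y | 0 < f y] by exact: (cvgr_gt _ c _ fz).
change (nbhs z (U `&` [set y | 0 < f y])).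
exact: (@filterI _ _ (nbhs_filter z) _ _ n1 n2).
Qed.

Lemma time_interval_open (R : realType) (T : \bar R) :
  open [set t : R | 0 < t /\ (t%:E < T)%E].
Proof.
have -> : [set t : R | 0 < t /\ (t%:E < T)%E] =
    [set t | 0 < t] `&` [set t | (t%:E < T)%E] by [].
apply: openI; first exact: open_gt.
case: T => [r| |].
- have -> : [set t : R | (t%:E < r%:E)%E] = [set t | t < r].
    by apply/funext => t /=; rewrite lte_fin.
  exact: open_lt.
- have -> : [set t : R | (t%:E < +oo)%E] = setT.
    by apply/funext => t /=; rewrite ltry; apply/propext; split.
  exact: openT.
have -> : [set t : R | (t%:E < -oo)%E] = set0.
  by apply/funext => t /=; rewrite ltNge leNye; apply/propext; split.
exact: open0.
Qed.

Section Representation.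
Variables (R : realType) (M : topologicalType) (A : surface_atlas R M) (T : \bar R).
Variables (X nu : M -> R -> 'rV[R]_3) (l1 l2 : M -> R -> R).
Hypothesis X_smooth : smooth_in_spacetime A T X.
Hypothesis X_embedding : forall t, time_interval T t ->
     smooth_embedding A (fun x => X x t).
Hypothesis nu_normal : forall t x, time_interval T t ->
     outer_unit_normal A (fun y => X y t) x (nu x t).
Hypothesis l_curvatures : forall t x, time_interval T t ->
     principal_curvatures A (fun y => X y t) (nu x t) x (l1 x t) (l2 x t).
Hypothesis strictly_convex : forall t x, time_interval T t ->
     0 < l1 x t /\ 0 < l2 x t.

Local Notation I := (time_interval T).
Variables (i : chart_index A) (P : 'M[R]_2).
Hypothesis Pu : P \in unitmx.

(** On the neighbourhood D of a point of space-time, g extends smoothly the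
position of the surface in the chart i, possibly to times outside of the time
interval, and sigma is the orientation given by the normal nu. *)
Record represents (g : spacetime R -> 'rV[R]_3) (D : pointed_open (spacetime R))
    (sigma : R) : Prop := Represents {
  rep_smooth : smooth (po_set D) g;
  rep_sigma : sigma ^+ 2 = 1;
  rep_gram : forall z, po_set D z -> 0 < gramX g P z;
  rep_gauss : forall z, po_set D z -> 0 < gauss_num g P (crossX g P z) z;
  rep_cod : forall z, po_set D z -> chart_cod i z.1;
  rep_X : forall z, po_set D z -> I z.2 -> X (param i z.1) z.2 = g z;
  rep_nu : forall z, po_set D z -> I z.2 ->
    coords (nu (param i z.1) z.2) =1 oriented_normal g P sigma z }.

(** Nondegeneracy, convexity and the sign of the mean curvature are open
conditions on g, and hold at the given point; D is cut out by them. *)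
Lemma representation u0 t0 : chart_cod i u0 -> I t0 ->
  exists g D sigma, [/\ represents g D sigma, po_point D = (u0, t0) &
    (0 < t0 -> forall z, po_set D z -> I z.2)].
Proof.
move=> u0c It0.
have [U [g [oU Uz0 sg gX]]] := X_smooth (conj u0c It0 : (chart_cod i `*` I) (u0, t0)).
pose U1 : set (spacetime R) := [set z | U z /\ chart_cod i z.1].
have oU1 : open U1.
  apply: openI => //; apply: (open_comp (f := fst)); last exact: chart_cod_open.
  by move=> z _; exact: cvg_fst.
have sg1 : smooth U1 g by apply: smooth_sub sg => z [].
have fg t : I t -> forall u', U1 (u', t) ->
    local_param (fun x => X x t) i u' = g (u', t).
  by move=> It u' [Uz' cu']; rewrite (gX _ Uz').
have fr u t : I t -> chart_cod i u ->
    row_free (frame (local_param (fun x => X x t) i) u).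
  by move=> It cu; have [_ h _ _] := X_embedding It; exact: h.
have orient z : U1 z -> I z.2 -> exists s, [/\ s ^+ 2 = 1,
     coords (nu (param i z.1) z.2) =1 unit_cross s (dX g P 0 z) (dX g P 1 z),
     0 < s * mean_num g P (crossX g P z) z & 0 < gauss_num g P (crossX g P z) z].
  case: z => u t Uz It; have cu : chart_cod i u := Uz.2.
  have [a0 b0] := strictly_convex (param i u) It.
  have [nn nf _] := nu_normal (param i u) It.
  have E := l_curvatures It cu (erefl (param i u)).
  exact: (local_orientation oU1 sg1 Pu Uz (fg t It) (fr u t It cu) a0 b0 E nn
    (nf i u cu (erefl _))).
have Uz1 : U1 (u0, t0) by split.
have [sigma [sigma2 nu0 mean0 gauss0]] := orient _ Uz1 It0.
have gram z : U1 z -> I z.2 -> 0 < gramX g P z.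
  case: z => u t Uz It.
  exact: (gramX_gt0 oU1 sg1 Pu Uz (fg t It) (fr u t It Uz.2)).
pose U2 := [set z | U1 z /\ 0 < gramX g P z].
have oU2 : open U2 by apply: open_gt0 => //; exact: smooth_gramX.
have sg2 : smooth U2 g by apply: smooth_sub sg1 => z [].
pose U3 := [set z | U2 z /\ 0 < gauss_num g P (crossX g P z) z].
have oU3 : open U3 by apply: open_gt0 => //; exact: smooth_gauss_num.
have sg3 : smooth U3 g by apply: smooth_sub sg2 => z [].
pose U4 := [set z | U3 z /\ 0 < sigma * mean_num g P (crossX g P z) z].
have oU4 : open U4.
  apply: open_gt0 => //.
  exact: (smoothM oU3 (smoothC U3 sigma) (smooth_mean_num P oU3 sg3)).
(* At positive times the neighbourhood is moreover contained in the time
   interval. *)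
pose U5 : set (spacetime R) := if 0 < t0 then
  U4 `&` snd @^-1` [set t : R | 0 < t /\ (t%:E < T)%E] else U4.
have oU5 : open U5.
  rewrite /U5; case: ifP => // _; apply: openI => //.
  apply: (open_comp (f := snd)); last exact: time_interval_open.
  by move=> z _; exact: cvg_snd.
have U54 z : U5 z -> U4 z.
  by rewrite /U5; case: (0 < t0); [move=> [Uz _]; exact: Uz | exact].
have U5z0 : U5 (u0, t0).
  have U4z0 : U4 (u0, t0).
    by split => //; split => //; split => //; exact: gram.
  by rewrite /U5; case: ifP => // t00; split => //; split => //; case: It0.
exists g, (PointedOpen oU5 U5z0), sigma; split; [|exact: erefl|]; last first.
  move=> t00 z; rewrite /= /U5 t00 => -[_ [/= tz zT]]; split; last exact: zT.
  exact: ltW.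
split; rewrite /po_set.
- by apply: smooth_sub sg3 => z /U54[].
- exact: sigma2.
- by move=> z /U54[[[]]].
- by move=> z /U54[[]].
- by move=> z /U54[[[[]]]].
- by move=> z /U54[[[[Uz cz]]]] _ _ _ Iz; rewrite gX.
move=> z /U54[[[Uz _] _] mz] Iz c.
have [s [s2 nuE ms _]] := orient z Uz Iz.
rewrite nuE; congr (unit_cross _ _ _ c).
(* Both signs give a positive mean curvature, hence they agree. *)
have sq1 (x : R) : x ^+ 2 = 1 -> x = 1 \/ x = -1.
  by move/eqP; rewrite sqrf_eq1 => /orP[/eqP|/eqP]; [left | right].
move: mz ms; move: (mean_num _ _ _ _) => m.
by case: (sq1 _ s2) => ->; case: (sq1 _ sigma2) => ->; lra.
Qed.

End Representation.

(** * Monotonicity of the maximum *)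

Lemma pinchHJE (R : realType) (a b : R) : 0 < a -> 0 < b ->
  pinchHJ (a + b) (a * b)^-1 = 2 * pinching a b.
Proof.
move=> a0 b0; rewrite /pinchHJ /pinching; field.
by rewrite !gt_eqF.
Qed.

Lemma rmorph_pinchHJ (A : comNzRingType) (R : realType) (ev : {rmorphism A -> R}) H J :
  ev (pinchHJ H J) = pinchHJ (ev H) (ev J).
Proof. by rewrite /pinchHJ !evE. Qed.

(** At interior times the derivative within the time interval is the ordinary
derivative of the extension. *)
Lemma derive_time (R : realType) (T : \bar R) (g : spacetime R -> 'rV[R]_3)
    (c : R -> 'rV[R]_3) (U : set (spacetime R)) u t d :
  open U -> U (u, t) -> (forall z, U z -> time_interval T z.2) ->
  (forall s, U (u, s) -> c s = g (u, s)) ->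
  differentiable g (u, t) -> time_derivative T c t d ->
  'D_((0, 1) : spacetime R) g (u, t) = d.
Proof.
move=> oU Uz UI cg dg ct; apply: cvg_lim => //.
have near_t : \forall s \near t, U (u, s).
  have : nbhs (u, t) U by apply: open_nbhs_nbhs.
  move=> [[A B] /= [nA nB] AB].
  by apply: filterS nB => s Bs; apply: AB; split => //=; exact: nbhs_singleton.
apply/cvgrPdist_lt => e e0; move/cvgrPdist_lt : ct => /(_ e e0).
rewrite /within /= => /nbhs_ballP[r1 /= r10 H1].
move: near_t => /nbhs_ballP[r2 /= r20 H2].
apply/nbhs_ballP; exists (Num.min r1 r2); first by rewrite /= lt_min r10.
move=> h; rewrite /= /ball /= sub0r normrN lt_min => /andP[hr1 hr2] h0.
have Uh : U (u, h + t) by apply: H2; rewrite /ball /= opprD addrCA subrr addr0 normrN.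
have := H1 (h + t); rewrite /ball /= opprD addrCA subrr addr0 normrN.
move=> /(_ hr1); have ht : h + t != t by rewrite -subr_eq0 addrK.
move=> /(_ ht (UI _ Uh)); rewrite addrK !cg //.
have E : h *: ((0, 1) : spacetime R) + (u, t) = (u, h + t).
  congr (_, _); first by rewrite /= scaler0 add0r.
  by congr (_ + _); rewrite /= [LHS]mulr1.
by rewrite /= E.
Qed.

Lemma left_lower_bound (R : realType) (phi : R -> R) (d e : R) :
  is_derive (0 : R) (1 : R) phi d -> d < e ->
  \forall h \near (0 : R)^'+, phi 0 - e * h < phi (- h).
Proof.
move=> [dphi dE] de.
have cv : h^-1 *: ((phi \o shift 0) (h *: (1 : R)) - phi 0) @[h --> (0 : R)^'] --> d.
  by rewrite -dE; exact: dphi.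
have H : \forall h \near (0 : R)^', h^-1 *: ((phi \o shift 0) (h *: (1 : R)) - phi 0) < e.
  by apply: cvgr_lt cv _ de.
move: H => /nbhs_ballP[r /= r0 H].
apply/nbhs_ballP; exists r => // h; rewrite /= /ball /= sub0r normrN => hr h0.
have hn : - h != 0 by rewrite oppr_eq0 gt_eqF.
have := H (- h); rewrite /ball /= sub0r opprK => /(_ hr hn).
rewrite addr0 [- h *: 1]mulr1 [_ *: _]mulrC invrN mulrN -mulNr ltr_pdivrMr //.
lra.
Qed.

Lemma pinching_ge0 (R : realType) (a b : R) : 0 <= pinching a b.
Proof.
rewrite /pinching; apply: divr_ge0; last first.
  by rewrite mulr_ge0 ?sqr_ge0 // mulr_ge0 ?sqr_ge0.
rewrite mulr_ge0 ?sqr_ge0 // mulr_ge0 ?exprn_even_ge0 //.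
by have := sqr_ge0 (a + b); have := sqr_ge0 a; have := sqr_ge0 b; nra.
Qed.

Section Consequences.
Variables (R : realType) (M : topologicalType) (A : surface_atlas R M) (T : \bar R).
Variables (X nu : M -> R -> 'rV[R]_3) (l1 l2 : M -> R -> R).
Hypothesis X_embedding : forall t, time_interval T t ->
     smooth_embedding A (fun x => X x t).
Hypothesis l_curvatures : forall t x, time_interval T t ->
     principal_curvatures A (fun y => X y t) (nu x t) x (l1 x t) (l2 x t).
Hypothesis strictly_convex : forall t x, time_interval T t ->
     0 < l1 x t /\ 0 < l2 x t.
Local Notation I := (time_interval T).
Variables (i : chart_index A) (P : 'M[R]_2).
Hypothesis Pu : P \in unitmx.
Variables (g : spacetime R -> 'rV[R]_3) (D : pointed_open (spacetime R)) (sigma : R).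
Hypothesis rep : represents T X nu i P g D sigma.
Local Notation U := (po_set D).

Let sg := rep_smooth rep.
Let s2 := rep_sigma rep.
Let gram0 := rep_gram rep.
Let gauss0 := rep_gauss rep.

Definition surf_X := loc_X sg.
Definition surf_n := loc_n sigma sg gram0 : 'I_3 -> smfun D.
Definition surf_G := loc_G sg gram0.
Definition surf_J := loc_J sg gauss0.
Definition surf_d j := loc_d P D j.
Definition surf_mean := mean_curv (surf_d 0) (surf_d 1) surf_X surf_n surf_G.
Definition surf_gauss := gauss_curv (surf_d 0) (surf_d 1) surf_X surf_n surf_G.
Definition surf_W := pinchHJ surf_mean surf_J.

Lemma rep_fg z : U z -> I z.2 ->
  forall u', U (u', z.2) -> local_param (fun x => X x z.2) i u' = g (u', z.2).
Proof. by move=> Uz Iz u' Uz'; exact: (rep_X rep Uz'). Qed.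

Lemma rep_free z : U z -> I z.2 ->
  row_free (frame (local_param (fun x => X x z.2) i) z.1).
Proof.
by move=> Uz Iz; have [_ h _ _] := X_embedding Iz; exact: h (rep_cod rep Uz).
Qed.

Lemma surf_curvatures z : U z -> I z.2 ->
  surf_mean z = l1 (param i z.1) z.2 + l2 (param i z.1) z.2 /\
  surf_gauss z = l1 (param i z.1) z.2 * l2 (param i z.1) z.2.
Proof.
move=> Uz Iz; have cz := rep_cod rep Uz.
have E := l_curvatures Iz cz (erefl _).
have nE := rep_nu rep Uz Iz.
have g0 := gram0 Uz.
have fg := rep_fg Uz Iz.
case: z Uz Iz cz E nE g0 fg => u t /= Uz It cz E nE g0 fg.
have [E1 E2] := curvature_num (po_open D) sg Pu Uz fg (rep_free Uz It) E.
have nc j k : normal_coef g P (coords (nu (param i u) t)) j k (u, t)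
    = normal_coef g P (oriented_normal g P sigma (u, t)) j k (u, t).
  by congr (- _); exact: eq_ip2.
have mE : mean_num g P (coords (nu (param i u) t)) (u, t)
    = mean_num g P (oriented_normal g P sigma (u, t)) (u, t).
  by rewrite /mean_num !nc.
have kE : gauss_num g P (coords (nu (param i u) t)) (u, t)
    = gauss_num g P (oriented_normal g P sigma (u, t)) (u, t).
  by rewrite /gauss_num !nc.
split.
  apply: (etrans (local_mean sigma sg gram0 Uz)).
  by rewrite -mE -E1 mulrC mulfK // gt_eqF.
apply: (etrans (local_gauss sg s2 gram0 Uz)).
by rewrite -kE -E2 mulrC mulfK // gt_eqF.
Qed.

Lemma surf_WE z : U z -> I z.2 ->
  surf_W z = 2 * pinching (l1 (param i z.1) z.2) (l2 (param i z.1) z.2).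
Proof.
move=> Uz Iz; have [mE kE] := surf_curvatures Uz Iz.
have [a0 b0] := strictly_convex (param i z.1) Iz.
rewrite -pinchHJE // -mE -kE.
have JE : surf_J z = (surf_gauss z)^-1.
  have k0 : surf_gauss z != 0 by rewrite kE mulf_neq0 // gt_eqF.
  apply: (mulfI k0); rewrite mulfV // -(smfunM _ _ Uz) -(smfun1 Uz).
  by congr (smfun_val _ z); exact: local_gauss_inv.
rewrite -JE; exact: (rmorph_pinchHJ (seval_rmorphism Uz) surf_mean surf_J).
Qed.

End Consequences.

Lemma smfun_flow_eval (R : realType) (V : normedModType R) (D : pointed_open V)
    (f h : smfun D) z : po_set D z ->
  (- (f ^+ 4 * h)) z = - (f z ^+ 4 * h z).
Proof.
by move=> Uz; rewrite !exprS expr0 !(smfunN, smfunM, smfun1).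
Qed.

Section Interior.
Variables (R : realType) (M : topologicalType) (A : surface_atlas R M) (T : \bar R).
Variables (X nu : M -> R -> 'rV[R]_3) (l1 l2 : M -> R -> R).
Hypothesis X_embedding : forall t, time_interval T t ->
     smooth_embedding A (fun x => X x t).
Hypothesis l_curvatures : forall t x, time_interval T t ->
     principal_curvatures A (fun y => X y t) (nu x t) x (l1 x t) (l2 x t).
Hypothesis strictly_convex : forall t x, time_interval T t ->
     0 < l1 x t /\ 0 < l2 x t.
Hypothesis X_flow : forall t x, time_interval T t ->
     time_derivative T (X x) t (- ((l1 x t + l2 x t) ^+ 4 *: nu x t)).
Local Notation I := (time_interval T).
Variables (i : chart_index A) (P : 'M[R]_2).
Hypothesis Pu : P \in unitmx.
Variables (g : spacetime R -> 'rV[R]_3) (D : pointed_open (spacetime R)) (sigma : R).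
Hypothesis rep : represents T X nu i P g D sigma.
Local Notation U := (po_set D).
Hypothesis interior : forall z, U z -> I z.2.

Definition time_dir : spacetime R := (0, 1).
Definition dtime := sderivation D time_dir.
Local Notation mean := (surf_mean rep).
Local Notation XX := (surf_X rep).
Local Notation nn := (surf_n rep).
Local Notation d1 := (surf_d P D 0).
Local Notation d2 := (surf_d P D 1).

(** As an identity of smooth functions on D, the flow equation can be
differentiated in space. *)
Lemma surf_flow c : dtime (XX c) = - (mean ^+ 4 * nn c).
Proof.
apply: smfunP => z Uz; have Iz := interior Uz.
apply: (etrans (der_loc_X (rep_smooth rep) time_dir c Uz)).
apply: etrans (esym (smfun_flow_eval _ _ Uz)).
have dg : differentiable g z by have [d _] := rep_smooth rep 1; exact: d.
have dv : derivable g z time_dir by exact: diff_derivable.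
apply: (etrans (esym (derive_coord c dv))).
have -> : 'D_time_dir g z =
    - ((l1 (param i z.1) z.2 + l2 (param i z.1) z.2) ^+ 4 *: nu (param i z.1) z.2).
  case: z Uz Iz dg dv => u t Uz It dg dv.
  have H := @X_flow t (param i u) It.
  have cg s : U (u, s) -> X (param i u) s = g (u, s).
    by move=> Us; exact: (rep_X rep Us (interior Us)).
  exact: (derive_time (po_open D) Uz interior cg dg H).
have [mE _] := surf_curvatures X_embedding l_curvatures Pu rep Uz Iz.
rewrite mE mxE mxE; congr (- (_ * _)).
apply: (etrans (rep_nu rep Uz Iz c)); apply: esym.
exact: loc_nE.
Qed.

Variables (u0 : 'rV[R]_2) (t0 : R).
Hypothesis D0 : po_point D = (u0, t0).
Let F := local_param (fun x => X x t0) i : 'rV[R]_2 -> 'rV[R]_3.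
Let x0 := param i u0.

Lemma U0 : U (u0, t0). Proof. by rewrite -D0; exact: po_in. Qed.

Hypothesis P_first : P *m first_form F u0 *m P^T = 1%:M.
Hypothesis P_second11 : (P *m second_form F u0 (nu x0 t0) *m P^T) 0 0 = l1 x0 t0.
Hypothesis P_second12 : (P *m second_form F u0 (nu x0 t0) *m P^T) 0 1 = 0.
Hypothesis P_second22 : (P *m second_form F u0 (nu x0 t0) *m P^T) 1 1 = l2 x0 t0.
Hypothesis nonumbilic : l1 x0 t0 != l2 x0 t0.
Hypothesis x0_max : forall y,
  pinching (l1 y t0) (l2 y t0) <= pinching (l1 x0 t0) (l2 x0 t0).

Lemma surf_W_space_max j : 'D_(dir P j) (surf_W rep) (u0, t0) = 0 /\
  'D_(dir P j) ('D_(dir P j) (surf_W rep)) (u0, t0) <= 0.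
Proof.
have It0 : I t0 := interior U0.
apply: (derive_local_max (po_open D) U0 (smfun_smooth (surf_W rep) 2)).
have n0 : nbhs (u0, t0) U by apply: open_nbhs_nbhs; split; [exact: po_open | exact: U0].
apply: filterS (near_line (dir P j) n0) => s.
have -> : (u0, t0) + s *: dir P j = (u0 + s *: row j P, t0).
  by congr (_, _); rewrite /= scaler0 addr0.
move=> Us.
rewrite (surf_WE X_embedding l_curvatures strictly_convex Pu rep Us (interior Us)).
rewrite (surf_WE X_embedding l_curvatures strictly_convex Pu rep U0 It0).
by rewrite ler_pM2l //; exact: x0_max.
Qed.

(** The equations of the flow hold in the ring of smooth functions on D, so
that [pinching_der_time_le0] applies, with evaluation at the point (u0, t0) as
the morphism to the real numbers. *)
Lemma surf_W_time_der_le0 : 'D_time_dir (surf_W rep) (u0, t0) <= 0.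
Proof.
have Uz := U0; have It0 : I t0 := interior Uz.
pose ev := seval_rmorphism Uz.
have fg := rep_fg rep Uz It0.
have [a0 b0] := strictly_convex x0 It0.
have first j k : ev (first_coef XX (surf_d P D j) (surf_d P D k)) = (1%:M : 'M[R]_2) j k.
  apply: (etrans (first_coefE P (rep_smooth rep) j k Uz)).
  rewrite -P_first; exact: (ip_dX P (po_open D) (rep_smooth rep) Uz fg).
have second j k : ev (second_coef XX nn (surf_d P D j) (surf_d P D k)) =
    (P *m second_form F u0 (nu x0 t0) *m P^T) j k.
  apply: (etrans (second_coefE sigma (rep_smooth rep) (rep_gram rep) j k Uz)).
  rewrite -(normal_coefE P (po_open D) (rep_smooth rep) Uz fg).
  congr (- _); apply: eq_ip2 => // c.
  by have := rep_nu rep Uz It0 c.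
have f11 : (1%:M : 'M[R]_2) 0 0 = 1 by rewrite mxE.
have f12 : (1%:M : 'M[R]_2) 0 1 = 0 by rewrite mxE.
have f22 : (1%:M : 'M[R]_2) 1 1 = 1 by rewrite mxE.
have [c1 h1] := surf_W_space_max 0; have [c2 h2] := surf_W_space_max 1.
have fr := local_frame (rep_smooth rep) (rep_sigma rep) (rep_gram rep).
have KJ := local_gauss_inv (rep_smooth rep) (rep_sigma rep) (rep_gram rep) (rep_gauss rep).
have comm := @sder_comm R _ D.
have two := @smfun_two_reg R _ D.
have := @pinching_der_time_le0 (smfun D) R ev d1 d2 dtime two (comm _ _)
  (comm _ _) (comm _ _) XX nn (surf_G rep) (surf_J rep) fr surf_flow KJ (l1 x0 t0) (l2 x0 t0)
  a0 b0 nonumbilic (etrans (first 0 0) f11) (etrans (first 0 1) f12)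
  (etrans (first 1 1) f22)
  (etrans (second 0 0) P_second11) (etrans (second 0 1) P_second12)
  (etrans (second 1 1) P_second22).
have E1 j : ev (surf_d P D j (surf_W rep)) = 'D_(dir P j) (surf_W rep) (u0, t0).
  exact: sderivationE.
have E2 j : ev (surf_d P D j (surf_d P D j (surf_W rep)))
    = 'D_(dir P j) ('D_(dir P j) (surf_W rep)) (u0, t0).
  exact: sderivation2E.
have Et : ev (dtime (surf_W rep)) = 'D_time_dir (surf_W rep) (u0, t0).
  exact: sderivationE.
move=> H; rewrite -Et; apply: H.
- exact: etrans (E1 0) c1.
- exact: etrans (E1 1) c2.
- by have := h1; rewrite -(E2 0).
- by have := h2; rewrite -(E2 1).
Qed.

Lemma pinching_left e : 0 < e -> \forall h \near (0 : R)^'+,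
  pinching (l1 x0 t0) (l2 x0 t0) - e * h < pinching (l1 x0 (t0 - h)) (l2 x0 (t0 - h)).
Proof.
move=> e0; have Uz := U0; have It0 : I t0 := interior Uz.
have dW : derivable (surf_W rep) ((u0, t0) + (0 : R) *: time_dir) time_dir.
  by rewrite scale0r addr0; apply: diff_derivable; exact: smfun_differentiable.
have D1 := is_derive_line dW; rewrite scale0r addr0 in D1.
have e2 : 'D_time_dir (surf_W rep) (u0, t0) < 2 * e.
  by apply: le_lt_trans surf_W_time_der_le0 _; rewrite mulr_gt0.
have H := left_lower_bound D1 e2.
have n0 : nbhs (u0, t0) U by apply: open_nbhs_nbhs; split; [exact: po_open | exact: U0].
have near_U : \forall h \near (0 : R)^'+, U (u0, t0 - h).
  have /nbhs_ballP[r /= r0 rU] := near_line time_dir n0.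
  apply/nbhs_ballP; exists r => // h; rewrite /ball /= sub0r normrN => hr _.
  have := rU (- h); rewrite /ball /= sub0r opprK => /(_ hr).
  have -> // : (u0, t0) + - h *: time_dir = (u0, t0 - h).
  by congr (_, _); rewrite /= ?scaler0 ?addr0 // [- h *: 1]mulr1.
have Hc := @filterI _ _ (at_right_proper_filter (0 : R)) _ _ H near_U.
apply: filterS Hc => h [].
have -> : (u0, t0) + - h *: time_dir = (u0, t0 - h).
  by congr (_, _); rewrite /= ?scaler0 ?addr0 // [- h *: 1]mulr1.
rewrite scale0r addr0 => lt Uh; move: lt.
rewrite (surf_WE X_embedding l_curvatures strictly_convex Pu rep Uh (interior Uh)).
rewrite (surf_WE X_embedding l_curvatures strictly_convex Pu rep Uz It0) /=.
rewrite -/x0 -mulrA -mulrBr ltr_pM2l //.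
Qed.

End Interior.

Section JointContinuity.
Variables (R : realType) (M : topologicalType) (A : surface_atlas R M) (T : \bar R).
Variables (X nu : M -> R -> 'rV[R]_3) (l1 l2 : M -> R -> R).
Hypothesis X_smooth : smooth_in_spacetime A T X.
Hypothesis X_embedding : forall t, time_interval T t ->
     smooth_embedding A (fun x => X x t).
Hypothesis nu_normal : forall t x, time_interval T t ->
     outer_unit_normal A (fun y => X y t) x (nu x t).
Hypothesis l_curvatures : forall t x, time_interval T t ->
     principal_curvatures A (fun y => X y t) (nu x t) x (l1 x t) (l2 x t).
Hypothesis strictly_convex : forall t x, time_interval T t ->
     0 < l1 x t /\ 0 < l2 x t.
Local Notation I := (time_interval T).

(** Joint continuity, including the initial time: near every point the
pinching function is the restriction of a smooth function. *)
Lemma pinching_continuous x t (Q : set R) : I t ->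
  nbhs (pinching (l1 x t) (l2 x t)) Q ->
  \forall x' \near x & t' \near within I (nbhs t), Q (pinching (l1 x' t') (l2 x' t')).
Proof.
move=> It nQ; have [i xi] := chart_cover A x.
have ui := chart_fun xi; set u := chart i x in ui.
have P1 : (1%:M : 'M[R]_2) \in unitmx by exact: unitmx1.
have [g [D [sigma [rep D0 _]]]] :=
  representation X_smooth X_embedding nu_normal l_curvatures strictly_convex P1 ui It.
have Uz : po_set D (u, t) by rewrite -D0; exact: po_in.
pose phi z := surf_W rep z / 2.
have phiE x' t' : chart_dom i x' -> I t' -> po_set D (chart i x', t') ->
    phi (chart i x', t') = pinching (l1 x' t') (l2 x' t').
  move=> xi' It' Uz'.
  rewrite /phi (surf_WE X_embedding l_curvatures strictly_convex P1 rep Uz' It') /=.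
  by rewrite (chartK xi') mulrC mulKf.
have cphi : {for (u, t), continuous phi}.
  by apply: continuousM; [exact: smfun_continuous | exact: cvg_cst].
have nU : nbhs (u, t) (po_set D).
  by apply: open_nbhs_nbhs; split; [exact: po_open | exact: Uz].
have nphi : nbhs (u, t) (phi @^-1` Q) by apply: cphi; rewrite phiE.
have [[B C] /= [nB nC] BC] := @filterI _ _ (nbhs_filter (u, t)) _ _ nU nphi.
exists ([set x' | chart_dom i x' /\ B (chart i x')], [set t' | I t' /\ C t']) => /=.
  split.
    apply: filterI.
      by apply: open_nbhs_nbhs; split => //; exact: chart_dom_open.
    exact: (chart_continuous xi nB).
  by rewrite /within /=; apply: filterS nC => t' Ct' It'; split.
move=> [x' t'] /= [[xi' Bx'] [It' Ct']].
by have [Uz' Qz'] := BC (chart i x', t') (conj Bx' Ct'); rewrite -phiE.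
Qed.

End JointContinuity.

Theorem theorem7p2 (R : realType) (M : topologicalType)
  (A : surface_atlas R M) (T : \bar R)
  (X nu : M -> R -> 'rV[R]_3) (l1 l2 : M -> R -> R)
  (M_closed : closed_manifold M)
  (X_smooth : smooth_in_spacetime A T X)
  (X_embedding : forall t, time_interval T t ->
     smooth_embedding A (fun x => X x t))
  (nu_normal : forall t x, time_interval T t ->
     outer_unit_normal A (fun y => X y t) x (nu x t))
  (l_curvatures : forall t x, time_interval T t ->
     principal_curvatures A (fun y => X y t) (nu x t) x (l1 x t) (l2 x t))
  (strictly_convex : forall t x, time_interval T t ->
     0 < l1 x t /\ 0 < l2 x t)
  (X_flow : forall t x, time_interval T t ->
     time_derivative T (X x) t (- ((l1 x t + l2 x t) ^+ 4 *: nu x t))) :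
  exists m : R -> R,
    (forall t, time_interval T t ->
       is_max [set pinching (l1 x t) (l2 x t) | x in [set: M]] (m t)) /\
    (forall s t, time_interval T s -> time_interval T t ->
       s <= t -> m t <= m s).
Proof.
have [M0 Mc _ _] := M_closed.
pose w x t := pinching (l1 x t) (l2 x t).
have joint := pinching_continuous X_smooth X_embedding nu_normal l_curvatures
  strictly_convex.
have I_convex a b t : time_interval T a -> time_interval T b -> a <= t <= b ->
    time_interval T t.
  move=> [a0 _] [_ bT] /andP[at_ tb]; split; first exact: le_trans a0 at_.
  by apply: le_lt_trans bT; rewrite lee_fin.
have w_cont t : time_interval T t -> continuous (w ^~ t).
  move=> It x Q /(joint x t Q It)[[B C] /= [nB nC] BC].
  apply: filterS nB => x' Bx'; apply: (BC (x', t)); split => //=.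
  exact: (nbhs_singleton nC) It.
have w_usc x t c : time_interval T t -> w x t < c ->
    \forall x' \near x & t' \near within (time_interval T) (nbhs t), w x' t' < c.
  move=> It wc; apply: (joint x t [set y | y < c] It).
  by apply: open_nbhs_nbhs; split; [exact: open_lt | exact: wc].
have w_left x t : time_interval T t -> (exists2 r, time_interval T r & r < t) ->
    (forall y, w y t <= w x t) ->
    forall e, 0 < e -> \forall h \near (0 : R)^'+, w x t - e * h < w x (t - h).
  move=> It [r [r0 _] rt] wmax e e0.
  have t0 : 0 < t by exact: le_lt_trans r0 rt.
  have [l12|l12] := eqVneq (l1 x t) (l2 x t).
    (* Umbilic points: w is nonnegative and vanishes at x. *)
    have -> : w x t = 0 by rewrite /w /pinching l12 subrr expr0n /= mulr0 mul0r.
    have n1 : \forall h \near (0 : R)^'+, 0 < h by exact: nbhs_right_gt.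
    apply: filterS n1 => h h0; rewrite sub0r.
    by apply: lt_le_trans (pinching_ge0 _ _); rewrite oppr_lt0 mulr_gt0.
  have [i xi] := chart_cover A x.
  have ui := chart_fun xi; have xE := chartK xi; set u := chart i x in ui xE.
  pose F := local_param (fun x => X x t) i : 'rV[R]_2 -> 'rV[R]_3.
  have ff : row_free (frame F u) by have [_ h _ _] := X_embedding t It; exact: h.
  have P1 : (1%:M : 'M[R]_2) \in unitmx by exact: unitmx1.
  (* A first representation, in the coordinate directions, only serves to
     see that the second fundamental form is symmetric; this allows to pass
     to orthonormal principal directions. *)
  have [g [D [sigma [rep D0 _]]]] :=
    representation X_smooth X_embedding nu_normal l_curvatures strictly_convex P1 ui It.
  have Uz : po_set D (u, t) by rewrite -D0; exact: po_in.
  have Bs := second_form_sym (po_open D) (rep_smooth rep) Uz (rep_fg rep Uz It) (nu x t).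
  have [P Pu [PG [B11 B12 B22]]] := simultaneous_diagonalization
    (first_form_unit ff) Bs (first_form_sym F u) (first_form_posdef ff)
    (l_curvatures t x It i u ui xE) l12.
  have [g' [D' [sigma' [rep' D0' int']]]] :=
    representation X_smooth X_embedding nu_normal l_curvatures strictly_convex Pu ui It.
  rewrite /w -xE.
  apply: (pinching_left X_embedding l_curvatures strictly_convex X_flow Pu rep'
    (int' t0) D0' PG); rewrite ?xE //.
have [m [mE mle]] := max_nonincreasing M0 Mc I_convex w_cont w_usc w_left.
exists m; split => // t It; have [x mx xmax] := mE t It; split.
  by exists x.
by move=> _ [y _ <-]; rewrite mx; exact: xmax.
Qed.
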